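(* Let $n \geq 2$ be any integer. (i) The identities $x^{n+1} \approx x^n$ and $xyx \approx x^2y$ constitute an identity basis for the variety $\operatorname{var}\{LZ_2^1,N_n^1\}$ of semigroups. (ii) The variety $\operatorname{var}\{LZ_2^1,N_n^1\}$ contains countably infinitely many subvarieties (that is, its set of subvarieties is countably infinite).
   Context: All varieties are varieties of semigroups, and all identities are semigroup identities; associativity is always assumed. For semigroups $S,T$, $\operatorname{var}\{S,T\}$ denotes the variety generated by $S$ and $T$, i.e. the smallest class of semigroups containing $S$ and $T$ and closed under homomorphic images, subsemigroups, and arbitrary direct products. An identity basis for a variety $\mathbf{V}$ is a set of identities satisfied by $\mathbf{V}$ from which every identity satisfied by $\mathbf{V}$ can be deduced. $LZ_2$ is the left zero band of order $2$ (multiplication $xy=x$), and $LZ_2^1$ is the monoid of order $3$ obtained from it by adjoining an identity element. $N_n=\langle a \mid a^n=0\rangle=\{a,a^2,\ldots,a^{n-1},0\}$ is the monogenic nilpotent semigroup of order $n$, and $N_n^1$ is the monoid obtained from $N_n$ by adjoining an identity element. *)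

(* Defs.v *)
From HB Require Import structures.
From mathcomp Require Import all_boot.
From mathcomp Require Import boolp classical_sets.

Set Implicit Arguments.
Unset Strict Implicit.
Unset Printing Implicit Defensive.

Local Open Scope group_scope.

(* A class of semigroups is a predicate [semigroupType -> Prop] rather than a
   [set semigroupType], which is ruled out by the universe constraints of the
   MathComp-Analysis sets.  The choice structure carried by a [semigroupType]
   is no restriction: [gen_choiceMixin] provides one on every type. *)

(** Free semigroup on the letters x_0, x_1, ... *)

(* [Word i s] is the nonempty word with first letter x_i, followed by the
   letters whose indices are listed in [s]. *)
Record word := Word { whead : nat; wtail : seq nat }.

HB.instance Definition _ := gen_eqMixin word.
HB.instance Definition _ := gen_choiceMixin word.

Definition word_mul (u v : word) : word :=
  Word (whead u) (wtail u ++ whead v :: wtail v).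

Fact word_mulA : associative word_mul.
Proof. by move=> [a s] [b t] [c r]; rewrite /word_mul /= -catA. Qed.

HB.instance Definition _ := isSemigroup.Build word word_mulA.

Definition letter (i : nat) : word := Word i [::].

(* Only meant for [0 < k]: a semigroup has no zeroth powers, and [spow s 0]
   is [s]. *)
Definition spow (S : semigroupType) (s : S) (k : nat) : S :=
  iterop k (fun a b : S => a * b) s s.

(* The unique homomorphism from the free semigroup to [S] that sends the letter
   x_i to [phi i]; when [S] is [word], it is a substitution. *)
Definition eval (S : semigroupType) (phi : nat -> S) (w : word) : S :=
  foldl (fun s i => s * phi i) (phi (whead w)) (wtail w).

(** Identities *)

(* The pair [(u, v)] stands for the identity u ≈ v. *)
Definition identity : Type := word * word.

Definition satisfies (S : semigroupType) (e : identity) : Prop :=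
  forall phi : nat -> S, eval phi e.1 = eval phi e.2.

Definition class_satisfies (V : semigroupType -> Prop) (e : identity) : Prop :=
  forall S : semigroupType, V S -> satisfies S e.

Inductive deducible (E : set identity) : identity -> Prop :=
| ded_hyp (e : identity) (sigma : nat -> word) :
    E e -> deducible E (eval sigma e.1, eval sigma e.2)
| ded_refl (u : word) : deducible E (u, u)
| ded_sym (u v : word) : deducible E (u, v) -> deducible E (v, u)
| ded_trans (u v w : word) :
    deducible E (u, v) -> deducible E (v, w) -> deducible E (u, w)
| ded_mul (u u' v v' : word) :
    deducible E (u, u') -> deducible E (v, v') ->
    deducible E (u * v, u' * v').

Definition identity_basis (V : semigroupType -> Prop) (E : set identity) : Prop :=
  (forall e, E e -> class_satisfies V e) /\
  (forall e, class_satisfies V e -> deducible E e).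

(** Varieties *)

Definition direct_product (I : Type) (F : I -> semigroupType) : Type :=
  forall i : I, F i.

Section DirectProduct.
Variables (I : Type) (F : I -> semigroupType).

HB.instance Definition _ := gen_eqMixin (direct_product F).
HB.instance Definition _ := gen_choiceMixin (direct_product F).

Definition direct_product_mul (f g : direct_product F) : direct_product F :=
  fun i => f i * g i.

Fact direct_product_mulA : associative direct_product_mul.
Proof.
by move=> f g h; apply: functional_extensionality_dep => i; apply: mulgA.
Qed.

HB.instance Definition _ :=
  isSemigroup.Build (direct_product F) direct_product_mulA.
End DirectProduct.

(* Semigroups are nonempty by convention, whereas a [semigroupType] may be
   empty, hence [variety_nonempty] and the hypothesis in [variety_sub].
   Subsemigroups are taken up to isomorphism, as domains of injective
   homomorphisms. *)
Record variety (V : semigroupType -> Prop) : Prop := {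
  variety_nonempty : forall S : semigroupType, V S -> inhabited S;
  variety_image : forall (S T : semigroupType) (f : {multiplicative S -> T}),
    V S -> (forall t : T, exists s : S, f s = t) -> V T;
  variety_sub : forall (S T : semigroupType) (f : {multiplicative T -> S}),
    V S -> inhabited T -> injective f -> V T;
  variety_prod : forall (I : Type) (F : I -> semigroupType),
    (forall i, V (F i)) -> V (direct_product F)
}.

(* var{S, T}, the intersection of all varieties containing [S] and [T]. *)
Definition var2 (S T : semigroupType) : semigroupType -> Prop :=
  fun U => forall V, variety V -> V S -> V T -> V U.

Definition subvariety (V W : semigroupType -> Prop) : Prop :=
  variety W /\ (forall S, W S -> V S).

Definition countably_infinite (X : Type) (A : X -> Prop) : Prop :=
  exists f : nat -> X,
    (forall i j, f i = f j -> i = j) /\ (forall a, A a <-> exists i, f i = a).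

(** The generating semigroups *)

(* [None] is the new identity element. *)
Definition adjoin1 (S : semigroupType) : Type := option S.

Section Adjoin1.
Variable S : semigroupType.

HB.instance Definition _ := Choice.on (adjoin1 S).

Definition adjoin1_mul (a b : adjoin1 S) : adjoin1 S :=
  match a, b with
  | Some s, Some t => Some (s * t)
  | None, _ => b
  | _, None => a
  end.

Fact adjoin1_mulA : associative adjoin1_mul.
Proof. by move=> [a|] [b|] [c|] //=; rewrite mulgA. Qed.

HB.instance Definition _ := isSemigroup.Build (adjoin1 S) adjoin1_mulA.

Fact adjoin1_mul1g : left_id (None : adjoin1 S) (fun a b => a * b).
Proof. by case. Qed.

Fact adjoin1_mulg1 : right_id (None : adjoin1 S) (fun a b => a * b).
Proof. by case. Qed.

HB.instance Definition _ :=
  Semigroup_isMonoid.Build (adjoin1 S) adjoin1_mul1g adjoin1_mulg1.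
End Adjoin1.

Definition LZ2 : Type := bool.

HB.instance Definition _ := Choice.on LZ2.

Definition LZ2_mul (a b : LZ2) : LZ2 := a.

Fact LZ2_mulA : associative LZ2_mul.
Proof. by []. Qed.

HB.instance Definition _ := isSemigroup.Build LZ2 LZ2_mulA.

(* The ordinal [i : 'I_n] stands for a^(i+1); in particular the last ordinal
   n-1 stands for a^n = 0. *)
Definition nilmon (n : nat) : Type := 'I_n.

Section NilMonogenic.
Variable n : nat.

HB.instance Definition _ := Choice.on (nilmon n).

Fact nilmon_mul_subproof (i j : 'I_n) : (minn (i + j).+1 n.-1 < n)%N.
Proof.
have n_gt0 := leq_ltn_trans (leq0n i) (ltn_ord i).
by rewrite gtn_min ltn_predL n_gt0 orbT.
Qed.

Definition nilmon_mul (i j : nilmon n) : nilmon n :=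
  Ordinal (nilmon_mul_subproof i j).

Fact nilmon_mulA : associative nilmon_mul.
Proof.
move=> i j k; apply/val_inj => /=; set m := n.-1.
have minS p q : minn (p + minn q.+1 m).+1 m = minn (p + q).+2 m.
  rewrite addn_minr -minnSS -minnA addnS; congr minn.
  by apply/minn_idPr; rewrite ltnW // ltnS leq_addl.
by rewrite minS [(minn _ m + k)%N]addnC minS [(k + _)%N]addnC addnA.
Qed.

HB.instance Definition _ := isSemigroup.Build (nilmon n) nilmon_mulA.
End NilMonogenic.

(* Main.v *)
(* The identities x^(n+1) = x^n and xyx = xxy collect all occurrences of a
   letter at the first one, so a word is determined by its profile: the sequence
   of its letters in order of first occurrence, each with its number of
   occurrences capped at n.  LZ_2^1 detects the order and N_n^1 the exponents,
   which is part (i).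

   For part (ii), a subvariety is determined by its identities (Birkhoff), so it
   is enough that every theory F containing the basis is finitely based.  This
   is a strong generating set argument.  Given u = v in F, let P be a common
   initial segment of the profiles of u and v and let x^a follow P in u.  Record
   the exponents of v, the length of P, the place of x in v, and a.  If E
   contains u' = v with P x^a initial in u', then v may be replaced by u', which
   agrees with u further than v does; so F is generated by any E that realizes
   the same records.  Substituting zs for z shows that the set of records is
   closed upwards for the gap order on exponent sequences, which is a
   well-quasi-order, so finitely many identities suffice.  Only the position of x
   in v matters, not the order of the letters of u: pairs of permutations are not
   well-quasi-ordered. *)

From HB Require Import structures.
Require Import Defs.
From mathcomp Require Import all_boot.
From mathcomp Require Import boolp classical_sets.
From mathcomp Require Import cardinality.
From mathcomp Require Import zify.

Set Implicit Arguments.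
Unset Strict Implicit.
Unset Printing Implicit Defensive.

Local Open Scope group_scope.

(** * Well-quasi-orders *)

Definition increasing (g : nat -> nat) : Prop :=
  forall i j, (i < j)%N -> (g i < g j)%N.

Lemma increasingP (g : nat -> nat) : (forall i, (g i < g i.+1)%N) -> increasing g.
Proof. by move=> gS i j; apply: (homo_ltn ltn_trans gS). Qed.

Definition ascending (A : Type) (R : A -> A -> Prop) (f : nat -> A) : Prop :=
  forall i j, (i < j)%N -> R (f i) (f j).

(** The subsequence form is chosen because products and unions then follow by thinning a sequence
    again. *)
Definition wqo (A : Type) (D : A -> Prop) (R : A -> A -> Prop) : Prop :=
  forall f : nat -> A, (forall i, D (f i)) ->
  exists2 g, increasing g & ascending R (f \o g).

Definition bad (A : Type) (D : A -> Prop) (R : A -> A -> Prop) (f : nat -> A) :=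
  (forall i, D (f i)) /\ forall i j, (i < j)%N -> ~ R (f i) (f j).

(** Dependent choice. *)
Lemma exists_iter (A : Type) (P : A -> Prop) (Q : A -> A -> Prop) :
  (forall a, P a -> exists2 b, P b & Q a b) -> forall a, P a ->
  exists f : nat -> A,
    [/\ f 0 = a, forall i, P (f i) & forall i, Q (f i) (f i.+1)].
Proof.
move=> PQ a0 Pa0.
have /choice[next nextP] a : exists b, P a -> P b /\ Q a b.
  have [Pa|nPa] := pselect (P a); last by exists a.
  by have [b Pb Qab] := PQ a Pa; exists b.
pose f i := iter i next a0.
have Pf i : P (f i) by elim: i => //= i /nextP[].
by exists f; split=> // i; apply: (nextP _ (Pf i)).2.
Qed.

(** If indices with no later term above them occurred arbitrarily far, they would form a bad
    sequence. So from some [N] on every term has a later one above it, and iterating this step gives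
    an ascending subsequence by transitivity. *)
Lemma wqo_no_bad (A : Type) (D : A -> Prop) (R : A -> A -> Prop) :
  (forall a b c, R a b -> R b c -> R a c) ->
  (forall f, ~ bad D R f) -> wqo D R.
Proof.
move=> Rtrans nobad f Df.
have [N HN] : exists N, forall i, (N <= i)%N -> exists2 j, (i < j)%N & R (f i) (f j).
  apply: contrapT => /forallNP noN.
  have noN' N : exists2 i, (N <= i)%N & forall j, (i < j)%N -> ~ R (f i) (f j).
    have /existsNP[i /not_implyP[Ni /forall2NP nj]] := noN N.
    by exists i => // j ij Rij; case: (nj j).
  pose P i := forall j, (i < j)%N -> ~ R (f i) (f j).
  have [i0 _ i0P] := noN' 0.
  have [i _|g [_ gP gS]] := exists_iter (P := P) (Q := fun i j => (i < j)%N) _ i0P.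
    by have [j ij jP] := noN' i.+1; exists j.
  apply: (nobad (f \o g)); split=> [i|i j ij] /=; first exact: Df.
  by apply: gP; apply: (increasingP gS).
have [i Ni|g [_ gP gS]] := exists_iter (P := leq N)
    (Q := fun i j => (i < j)%N /\ R (f i) (f j)) _ (leqnn N).
  have [j ij Rij] := HN i Ni.
  by exists j => //; apply: leq_trans Ni (ltnW ij).
exists g; first by apply: increasingP => i; apply: (gS i).1.
move=> i j; elim: j => // j IHj; rewrite ltnS leq_eqVlt => /predU1P[->|ij] /=.
  exact: (gS j).2.
exact: Rtrans (IHj ij) (gS j).2.
Qed.

Lemma wqo_bad (A : Type) (D : A -> Prop) (R : A -> A -> Prop) f :
  wqo D R -> ~ bad D R f.
Proof.
move=> wqoR [Df badf]; have [g incr_g asc] := wqoR f Df.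
exact: (badf _ _ (incr_g 0 1%N isT)) (asc 0 1%N isT).
Qed.

Lemma wqo_sub (A : Type) (D D' : A -> Prop) (R R' : A -> A -> Prop) :
  (forall a, D' a -> D a) -> (forall a b, R a b -> R' a b) ->
  wqo D R -> wqo D' R'.
Proof.
move=> DD RR wqoR f Df; have [i|g incr_g asc] := wqoR f; first exact/DD/Df.
by exists g => // i j ij; apply/RR/asc.
Qed.

Lemma wqo_image (A B : Type) (h : A -> B) (D : A -> Prop) (D' : B -> Prop)
    (R : A -> A -> Prop) (R' : B -> B -> Prop) :
  (forall b, D' b -> exists2 a, D a & h a = b) ->
  (forall a b, D a -> D b -> R a b -> R' (h a) (h b)) ->
  wqo D R -> wqo D' R'.
Proof.
move=> hsurj hR wqoR f Df.
have /choice[f' f'P] i : exists a, D a /\ h a = f i.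
  by have [a Da ha] := hsurj _ (Df i); exists a.
have [i|g incr_g asc] := wqoR f'; first exact: (f'P i).1.
exists g => // i j ij /=; rewrite -(f'P (g i)).2 -(f'P (g j)).2.
by apply: hR; [exact: (f'P _).1 | exact: (f'P _).1 | exact: asc].
Qed.

Lemma wqo_prod (A B : Type) (D : A -> Prop) (D' : B -> Prop)
    (R : A -> A -> Prop) (R' : B -> B -> Prop) :
  wqo D R -> wqo D' R' ->
  wqo (fun c : A * B => D c.1 /\ D' c.2) (fun c d => R c.1 d.1 /\ R' c.2 d.2).
Proof.
move=> wqoR wqoR' f Df.
have [i|g incr_g asc] := wqoR (fst \o f); first exact: (Df i).1.
have [i|g' incr_g' asc'] := wqoR' (snd \o f \o g); first exact: (Df (g i)).2.
exists (g \o g') => [i j ij|i j ij] /=; first exact/incr_g/incr_g'.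
by split; [apply/asc/incr_g' | apply: asc'].
Qed.

(** Either a tail of the sequence stays in [D1], or infinitely many terms lie in [D2]. *)
Lemma wqo_union (A : Type) (D1 D2 : A -> Prop) (R : A -> A -> Prop) :
  wqo D1 R -> wqo D2 R -> wqo (fun a => D1 a \/ D2 a) R.
Proof.
move=> wqo1 wqo2 f Df.
have [[N HN]|noN] := pselect (exists N, forall i, (N <= i)%N -> D1 (f i)).
  have [i|g incr_g asc] := wqo1 (fun i => f (N + i)); first exact/HN/leq_addr.
  by exists (fun i => N + g i) => // i j ij; rewrite ltn_add2l incr_g.
have noN' N : exists2 i, (N <= i)%N & D2 (f i).
  have /forallNP/(_ N)/existsNP[i /not_implyP[Ni nD1]] := noN.
  by exists i => //; case: (Df i).
have [i0 _ Di0] := noN' 0.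
have [i _|h [_ hP hS]] :=
    exists_iter (P := fun i => D2 (f i)) (Q := fun i j => (i < j)%N) _ Di0.
  by have [j ij Dj] := noN' i.+1; exists j.
have [i|g incr_g asc] := wqo2 (f \o h); first exact: hP.
by exists (h \o g) => // i j ij; apply/(increasingP hS)/incr_g.
Qed.

(** The infinite pigeonhole principle. *)
Lemma wqo_leq (n : nat) : wqo (fun a => (a <= n)%N) eq.
Proof.
elim: n => [|n IHn].
  move=> f f0; exists id => // i j _ /=.
  by move: (f0 i) (f0 j); rewrite !leqn0 => /eqP-> /eqP->.
apply: (@wqo_sub _ (fun a => (a <= n)%N \/ a = n.+1) _ eq) => //.
  by move=> a; rewrite leq_eqVlt => /predU1P[]; [right | left].
by apply: wqo_union => // f fE; exists id => // i j _ /=; rewrite !fE.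
Qed.

(** Otherwise a list could be extended forever by an element of [P] that is above none of the
    earlier ones, and the added elements would form a bad sequence. *)
Lemma wqo_finite_basis (A : eqType) (D : A -> Prop) (R : A -> A -> Prop)
    (P : A -> Prop) :
  wqo D R -> (forall a, P a -> D a) ->
  exists2 l : seq A, (forall a, a \in l -> P a) &
    forall a, P a -> exists2 b, b \in l & R b a.
Proof.
move=> wqoR PD; apply: contrapT => /forall2NP nobasis.
pose Q (l : seq A) := forall a, a \in l -> P a.
have Q0 : Q [::] by [].
have [l Ql|f [_ fP fS]] := exists_iter (P := Q)
  (Q := fun l l' => exists a, l' = a :: l /\ forall b, b \in l -> ~ R b a) _ Q0.
  case: (nobasis l) => // /existsNP[a /not_implyP[Pa nba]].
  exists (a :: l); first by move=> b; rewrite inE => /predU1P[->|/Ql].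
  by exists a; split=> // b bl Rba; apply: nba; exists b.
have [a aP] := choice fS.
have a_in i j : (i < j)%N -> a i \in f j.
  elim: j => // j IHj; rewrite ltnS leq_eqVlt (aP j).1 inE.
  by move=> /predU1P[->|/IHj->]; rewrite ?eqxx ?orbT.
apply: (@wqo_bad _ D R a) => //; split=> [i|i j ij].
  by apply/PD/(fP i.+1)/a_in.
by apply: (aP j).2; apply: a_in.
Qed.

(** * Higman's lemma *)

Inductive emb (A : Type) (R : A -> A -> Prop) : seq A -> seq A -> Prop :=
| emb_nil t : emb R [::] t
| emb_skip y s t : emb R s t -> emb R s (y :: t)
| emb_cons x y s t : R x y -> emb R s t -> emb R (x :: s) (y :: t).

Fixpoint every (A : Type) (D : A -> Prop) (s : seq A) : Prop :=
  if s is x :: s' then D x /\ every D s' else True.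

Lemma emb_trans (A : Type) (R : A -> A -> Prop) :
  (forall a b c, R a b -> R b c -> R a c) ->
  forall s t u, emb R s t -> emb R t u -> emb R s u.
Proof.
move=> Rtrans s t u + tu; elim: tu s => {t u}.
- by move=> u s st; inversion st; constructor.
- by move=> y t u _ IH s /IH; constructor.
- move=> x y t u Rxy _ IH s st.
  inversion st as [|? ? ? st'|z ? s' ? Rzx st']; subst.
  + by constructor.
  + by constructor; apply: IH.
  + by constructor; [apply: Rtrans Rzx Rxy | apply: IH].
Qed.

(* Nash-Williams: in a minimal bad sequence, dropping the heads along a
   subsequence whose heads ascend gives a smaller bad sequence. *)
Theorem higman (A : Type) (D : A -> Prop) (R : A -> A -> Prop) :
  (forall a b c, R a b -> R b c -> R a c) -> wqo D R -> wqo (every D) (emb R).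
Proof.
move=> Rtrans wqoR; apply: wqo_no_bad; first exact: emb_trans.
move=> f0 bad0.
(* A pair [(k, m)] with [ext k m] is a prefix of length [k] that starts some bad sequence; dependent
   choice runs over such pairs. *)
pose ext k (m : nat -> seq A) :=
  exists2 f, bad (every D) (emb R) f & forall i, (i < k)%N -> f i = m i.
pose upd (m : nat -> seq A) k a := fun i => if i == k then a else m i.
have eq_ext k m m' : (forall i, (i < k)%N -> m i = m' i) -> ext k m -> ext k m'.
  by move=> mm' [f badf fm]; exists f => // i ik; rewrite fm ?mm'.
(* The prefix grows by a term of least size among those that still leave it the start of a bad
   sequence. *)
have minstep c : ext c.1 c.2 -> exists2 d, ext d.1 d.2 &
    d.1 = c.1.+1 /\ exists a, d.2 = upd c.2 c.1 a /\
      forall b, ext c.1.+1 (upd c.2 c.1 b) -> (size a <= size b)%N.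
  case: c => k m [/= f badf fm].
  have ext_size : exists s, `[< exists a, ext k.+1 (upd m k a) /\ size a = s >].
    exists (size (f k)); apply/asboolP; exists (f k); split=> //; exists f => //.
    by move=> i; rewrite /upd ltnS leq_eqVlt; case: eqP => [->|_] //= /fm.
  case: (ex_minnP ext_size) => s /asboolP[a [exta <-]] mins.
  exists (k.+1, upd m k a) => //=; split=> //; exists a; split=> // b extb.
  by apply: mins; apply/asboolP; exists b.
have ext0 : ext (0, f0).1 (0, f0).2 by exists f0.
have [F [F0 FP FS]] := exists_iter minstep ext0.
have F1 i : (F i).1 = i by elim: i => [|i IHi]; rewrite ?F0 // (FS i).1 IHi.
(* Stage [i.+1] fixes the term [i] for good, so the diagonal [m] is the minimal bad sequence. *)
pose m i := (F i.+1).2 i.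
have Fm k i : (i < k)%N -> (F k).2 i = m i.
  elim: k => // k IHk; rewrite ltnS leq_eqVlt => /predU1P[->//|ik].
  have [_ [a [-> _]]] := FS k; rewrite /upd F1 -IHk //.
  by rewrite ifN // neq_ltn ik.
have extm k : ext k m by have := FP k; rewrite F1; apply: eq_ext; apply: Fm.
have minm k b : ext k.+1 (upd m k b) -> (size (m k) <= size b)%N.
  move=> extb; have [_ [a [ka mina]]] := FS k; rewrite /m ka F1 /upd eqxx.
  apply: mina; rewrite F1; apply: eq_ext extb => i; rewrite /upd ltnS leq_eqVlt.
  by case: eqP => //= _ /Fm.
have badm : bad (every D) (emb R) m.
  split=> [i|i j ij].
    by have [f [Df _] /(_ i (ltnSn i))<-] := extm i.+1.
  have [f [_ badf] fm] := extm j.+1.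
  by rewrite -!fm ?ltnS ?(ltnW ij) //; apply: badf.
have m_neq0 i : exists c, m i = c.1 :: c.2.
  case mi: (m i) => [|x s]; last by exists (x, s).
  by case: (badm.2 i i.+1); rewrite // mi; constructor.
have [c cE] := choice m_neq0.
have Dc i : D (c i).1 /\ every D (c i).2 by have := badm.1 i; rewrite cE.
have [i|g incr_g asc] := wqoR (fst \o c); first exact: (Dc i).1.
(* The smaller bad sequence agrees with [m] before [g 0] and then lists the tails along [g]; its
   term at [g 0] is shorter than that of [m]. *)
suff /minm : ext (g 0).+1 (upd m (g 0) (c (g 0)).2) by rewrite cE /= ltnn.
exists (fun i => if (i < g 0)%N then m i else (c (g (i - g 0))).2); last first.
  move=> i; rewrite /upd ltnS leq_eqVlt.
  by case: eqP => [->|_ /= ->] //; rewrite ltnn subnn.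
split=> [i|i j ij]; first by case: ifP => _; [apply: badm.1 | apply: (Dc _).2].
case: ifP => [ig|/negbT]; last rewrite -leqNgt => gi.
  case: ifP => [jg|/negbT]; [exact: badm.2|rewrite -leqNgt => gj emb_ij].
  apply: (badm.2 i (g (j - g 0))); last by rewrite [m (g _)]cE; constructor.
  apply: (leq_trans ig); case: (posnP (j - g 0)) => [->|j0] //.
  exact/ltnW/incr_g.
rewrite ltnNge (leq_trans gi (ltnW ij)) /= => emb_ij.
have gij : (i - g 0 < j - g 0)%N by rewrite ltn_sub2r // (leq_ltn_trans gi).
apply: (badm.2 _ _ (incr_g _ _ gij)).
by rewrite !cE; constructor=> //; apply: asc.
Qed.

(** * The gap order on exponent sequences *)

(* The side condition [a <= c] is what substituting [z s] for a letter [z] of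
   exponent [a] can achieve: it inserts [s] after [z] with exponent [a], which
   right multiplication by [s] then raises to any [c <= n]. *)
Inductive gap (n : nat) (s : seq nat) : seq nat -> Prop :=
| gap_refl : gap n s s
| gap_ins s1 a c s2 : gap n s (s1 ++ a :: s2) -> (a <= c <= n)%N ->
    gap n s (s1 ++ a :: c :: s2).

Section Gap.
Variable n : nat.

Definition exps_in (m : nat) (s : seq nat) : bool := all (fun a => m <= a <= n)%N s.

Lemma gap_trans s t u : gap n s t -> gap n t u -> gap n s u.
Proof. by move=> st; elim=> // s1 a c s2 _ IH ac; apply: gap_ins. Qed.

Lemma gap_cat s t s' t' : gap n s s' -> gap n t t' -> gap n (s ++ t) (s' ++ t').
Proof.
move=> ss tt; apply: (@gap_trans _ (s' ++ t)).
  elim: {s'}ss => [|s1 a c s2 _ IH ac]; first exact: gap_refl.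
  by move: IH; rewrite -!catA !cat_cons => IH; apply: gap_ins.
elim: {t'}tt => [|s1 a c s2 _ IH ac]; first exact: gap_refl.
by rewrite catA; apply: gap_ins => //; rewrite -catA.
Qed.

(** The entries of [B] are inserted from the last to the first, each directly after the leading [m],
    which is below all of them. *)
Lemma gap_insert m B s : exps_in m B -> gap n (m :: s) (m :: B ++ s).
Proof.
elim: B => [|b B IH] /=; first by move=> _; apply: gap_refl.
by move=> /andP[mb /IH gapB]; apply: (@gap_ins _ _ [::]).
Qed.

(** A sequence with least entry [m] is cut at the occurrences of [m]. In [join], [c.1] precedes the
    first one, [c.2.1] lists the blocks between consecutive ones, and [c.2.2] follows the last. *)
Let blocks m (L : seq (seq nat)) := flatten [seq m :: B | B <- L].

Let join m (c : seq nat * (seq (seq nat) * seq nat)) :=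
  c.1 ++ blocks m c.2.1 ++ m :: c.2.2.

Lemma exps_in_split m s : (m <= n)%N -> exps_in m s ->
  exps_in m.+1 s \/
  exists2 c, exps_in m.+1 c.1 /\ (every (exps_in m.+1) c.2.1 /\ exps_in m.+1 c.2.2) &
    join m c = s.
Proof.
move=> mn; elim: s => [|x s IH] /=; first by left.
case/andP=> /andP[mx xn] /IH{}IH; move: mx; rewrite leq_eqVlt => /predU1P[<-|mx].
  right; case: IH => [s_in|[[B0 [L B]] [/= B0in [Lin Bin]] <-]].
    by exists ([::], ([::], s)).
  by exists ([::], (B0 :: L, B)) => //=; rewrite /join /= -!catA.
case: IH => [s_in|[[B0 [L B]] [/= B0in [Lin Bin]] <-]].
  by left; rewrite mx xn.
by right; exists (x :: B0, (L, B)) => //=; rewrite mx xn.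
Qed.

(** A surplus block [C] arises by inserting [C] and a further [m] after an existing [m]. This needs
    an [m] at the end of each block, so the part after the last [m] is matched separately. *)
Lemma gap_blocks m L L' B B' : (m <= n)%N -> every (exps_in m) L' ->
  emb (gap n) L L' -> gap n B B' ->
  gap n (blocks m L ++ m :: B) (blocks m L' ++ m :: B').
Proof.
move=> mn + embL gapB.
have cons_m K : exists r, blocks m K ++ m :: B' = m :: r.
  by case: K => [|C K]; [exists B' | exists (C ++ blocks m K ++ m :: B'); rewrite /= catA].
have skip C K s : exps_in m C -> gap n s (blocks m K ++ m :: B') ->
    gap n s (blocks m (C :: K) ++ m :: B').
  move=> Cin gaps; apply: gap_trans gaps _; rewrite /= -catA.
  have [r ->] := cons_m K.
  have -> : C ++ m :: r = (C ++ [:: m]) ++ r by rewrite -catA.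
  apply: gap_insert; rewrite /exps_in all_cat -/(exps_in m C) Cin /=.
  by rewrite leqnn mn.
elim: embL => [K|C K K' _ IH|C C' K K' gapC _ IH] /=.
- elim: K => [_|C K IH [Cin Kin]]; last exact/skip/IH.
  by apply: (@gap_cat [:: m] _ [:: m]); first exact: gap_refl.
- by case=> Cin /IH; apply: skip.
- case=> _ /IH gapK; rewrite -!catA.
  by apply: (@gap_cat [:: m] _ [:: m]); [exact: gap_refl | apply: gap_cat].
Qed.

Lemma exps_in_le m m' s : (m <= m')%N -> exps_in m' s -> exps_in m s.
Proof. by move=> mm'; apply: sub_all => a /andP[/(leq_trans mm')->]. Qed.

Lemma every_sub (A : Type) (D D' : A -> Prop) s :
  (forall a, D a -> D' a) -> every D s -> every D' s.
Proof. by move=> DD'; elim: s => //= a s IH [/DD'? /IH]. Qed.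

(** Induction on the number of values from [m] to [n]: the parts between the occurrences of [m] have
    entries above [m], and Higman's lemma handles the list of blocks. *)
Theorem gap_wqo m : wqo (exps_in m) (gap n).
Proof.
move: {2}(n.+1 - m)%N (leqnn (n.+1 - m)) => k; elim: k m => [|k IHk] m.
  rewrite leqn0 subn_eq0 => nm.
  apply: (@wqo_sub _ (fun s => s = [::]) _ (gap n)) => //; last first.
    by move=> f fE; exists id => // i j _ /=; rewrite !fE; apply: gap_refl.
  by case=> //= x s /andP[/andP[mx xn]]; lia.
move=> mk; have [nm|mn] := ltnP n m; first by apply: IHk; lia.
have wqoS : wqo (exps_in m.+1) (gap n) by apply: IHk; lia.
have wqoJ := wqo_prod wqoS (wqo_prod (higman gap_trans wqoS) wqoS).
have wqoI : wqo (fun s => exists2 c, exps_in m.+1 c.1 /\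
    (every (exps_in m.+1) c.2.1 /\ exps_in m.+1 c.2.2) & join m c = s) (gap n).
  apply: wqo_image wqoJ; first by move=> s [c cD <-]; exists c.
  move=> [B0 [L B]] [B0' [L' B']] /= _ [_ [Lin _]] [gap0 [embL gapB]].
  apply: gap_cat => //; apply: gap_blocks => //.
  exact: every_sub (fun s => @exps_in_le _ _ s (leqnSn m)) Lin.
by apply: wqo_sub (wqo_union wqoS wqoI) => // s; apply: exps_in_split.
Qed.
End Gap.

(** * Deduction on lists of letters *)

Definition letters (w : word) : seq nat := whead w :: wtail w.

Definition word_of (s : seq nat) : word := Word (head 0 s) (behead s).

Lemma lettersK : cancel letters word_of. Proof. by case. Qed.

Lemma letters_mul u v : letters (u * v) = letters u ++ letters v.
Proof. by []. Qed.

Lemma word_ofK s : ~~ nilp s -> letters (word_of s) = s. Proof. by case: s. Qed.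

Lemma word_of_cat s t : ~~ nilp s -> ~~ nilp t ->
  word_of (s ++ t) = word_of s * word_of t.
Proof. by case: s t => [//|x s] [|y t]. Qed.

Lemma eval_mul (S : semigroupType) (phi : nat -> S) u v :
  eval phi (u * v) = eval phi u * eval phi v.
Proof.
rewrite /eval /= foldl_cat /=; set a := foldl _ _ (wtail u).
by elim/last_ind: (wtail v) => //= t x IH; rewrite !foldl_rcons IH mulgA.
Qed.

Lemma eval_letter (S : semigroupType) (phi : nat -> S) i :
  eval phi (letter i) = phi i.
Proof. by []. Qed.

Lemma word_ind (P : word -> Prop) :
  (forall i, P (letter i)) -> (forall w i, P w -> P (w * letter i)) ->
  forall w, P w.
Proof.
move=> P1 PM [a s]; elim/last_ind: s => [|s x IH]; first exact: P1.
have -> : Word a (rcons s x) = Word a s * letter x.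
  by rewrite -cats1.
exact: PM.
Qed.

Lemma eval_eval (S : semigroupType) (phi : nat -> S) (sigma : nat -> word) w :
  eval phi (eval sigma w) = eval (fun i => eval phi (sigma i)) w.
Proof. by elim/word_ind: w => // w i IH; rewrite !eval_mul IH. Qed.

Lemma letters_eval (sigma : nat -> word) w :
  letters (eval sigma w) = flatten [seq letters (sigma i) | i <- letters w].
Proof.
elim/word_ind: w => [i|w i IH]; first by rewrite /= cats0.
by rewrite eval_mul !letters_mul IH map_cat flatten_cat /= cats0.
Qed.

Lemma deducible_ax (E : set identity) e : E e -> deducible E e.
Proof.
have evalK w : eval letter w = w by elim/word_ind: w => // w i IH; rewrite eval_mul IH.
by case: e => u v /(ded_hyp letter); rewrite !evalK.
Qed.

Lemma deducible_subst E e (sigma : nat -> word) :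
  deducible E e -> deducible E (eval sigma e.1, eval sigma e.2).
Proof.
elim=> {e} /= [e tau Ee|w|u v _|u v w _ + _|u u' v v' _ IH _ IH'].
- by rewrite !eval_eval; apply: ded_hyp.
- exact: ded_refl.
- exact: ded_sym.
- exact: ded_trans.
- by rewrite !eval_mul; apply: ded_mul.
Qed.

Lemma deducible_sub (E E' : set identity) :
  (forall e, E e -> deducible E' e) -> forall e, deducible E e -> deducible E' e.
Proof.
move=> EE' e; elim=> {e} [e sigma /EE'|w|u v _|u v w _ + _|u u' v v' _ + _].
- exact: deducible_subst.
- exact: ded_refl.
- exact: ded_sym.
- exact: ded_trans.
- exact: ded_mul.
Qed.

(** Lists may be empty while words may not. As [word_of] sends the empty list to the letter 0,
    emptiness is compared separately. *)
Definition ded (E : set identity) (s t : seq nat) : Prop :=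
  nilp s = nilp t /\ deducible E (word_of s, word_of t).

Section Ded.
Variable E : set identity.

Lemma ded_letters u v : ded E (letters u) (letters v) <-> deducible E (u, v).
Proof. by split=> [[_]|duv]; last split=> //; rewrite !lettersK. Qed.

Lemma dedxx s : ded E s s. Proof. by split=> //; apply: ded_refl. Qed.

Lemma dedC s t : ded E s t -> ded E t s.
Proof. by case=> nst dst; split; [rewrite nst | apply: ded_sym]. Qed.

Lemma ded_tr s t u : ded E s t -> ded E t u -> ded E s u.
Proof.
by case=> nst dst [ntu dtu]; split; [rewrite nst | apply: ded_trans dst dtu].
Qed.

Lemma ded_cat s s' t t' : ded E s s' -> ded E t t' -> ded E (s ++ t) (s' ++ t').
Proof.
move=> [ns ds] [nt dt].
have [s0|sn0] := boolP (nilp s).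
  by move: s0 (s0); rewrite {2}ns => /nilP-> /nilP->.
have [t0|tn0] := boolP (nilp t).
  by move: t0 (t0); rewrite {2}nt => /nilP-> /nilP->; rewrite !cats0.
split; last by rewrite !word_of_cat -?ns -?nt //; apply: ded_mul.
by rewrite /nilp !size_cat !addn_eq0 -/(nilp s) -/(nilp t) -/(nilp s') -/(nilp t') ns nt.
Qed.

Lemma ded_map (tau : nat -> seq nat) s t : (forall i, ~~ nilp (tau i)) ->
  ded E s t -> ded E (flatten (map tau s)) (flatten (map tau t)).
Proof.
move=> tau_n0 [nst dst].
have [s0|sn0] := boolP (nilp s).
  by move: s0 (s0); rewrite {2}nst => /nilP-> /nilP->; apply: dedxx.
have tn0 : ~~ nilp t by rewrite -nst.
have tauE r : ~~ nilp r -> flatten (map tau r) =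
    letters (eval (word_of \o tau) (word_of r)).
  move=> rn0; rewrite letters_eval word_ofK //; congr flatten.
  by apply: eq_map => i /=; rewrite word_ofK.
by rewrite !tauE //; apply/ded_letters/(deducible_subst _ dst).
Qed.
End Ded.

Lemma ded_sub (E E' : set identity) s t :
  (forall e, E e -> deducible E' e) -> ded E s t -> ded E' s t.
Proof. by move=> EE' [nst dst]; split=> //; apply: deducible_sub dst. Qed.

(** * Profiles *)

Fixpoint firsts (s : seq nat) : seq nat :=
  if s is x :: s' then x :: [seq y <- firsts s' | y != x] else [::].

Lemma mem_firsts s : firsts s =i s.
Proof.
move=> y; elim: s => //= x s IH; rewrite !inE mem_filter IH.
by case: eqP.
Qed.

Lemma firsts_uniq s : uniq (firsts s).
Proof. by elim: s => //= x s IH; rewrite filter_uniq // mem_filter eqxx. Qed.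

Lemma firsts_id s : uniq s -> firsts s = s.
Proof.
elim: s => //= x s IH /andP[xs /IH->]; congr cons.
apply/all_filterP; apply/allP => y.
by apply: contraTneq => ->.
Qed.

Lemma firsts_cat s t : firsts (s ++ t) = firsts s ++ [seq x <- firsts t | x \notin s].
Proof.
elim: s => [|x s IH] /=; first by rewrite filter_predT.
rewrite IH filter_cat -filter_predI; congr (_ :: _ ++ _).
by apply: eq_filter => y /=; rewrite inE negb_or.
Qed.

Lemma firsts_rcons s x : firsts (rcons s x) = if x \in s then firsts s else rcons (firsts s) x.
Proof. by rewrite -cats1 firsts_cat /=; case: (x \in s); rewrite /= ?cats0 ?cats1. Qed.

(** The image of a repeated letter contains only letters that have already occurred. *)
Lemma firsts_flatten (tau : nat -> seq nat) s :
  firsts (flatten (map tau s)) = firsts (flatten (map tau (firsts s))).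
Proof.
elim/last_ind: s => // s x IH; rewrite firsts_rcons map_rcons flatten_rcons firsts_cat IH.
case: ifP => xs; last by rewrite map_rcons flatten_rcons firsts_cat; congr (_ ++ _);
  apply: eq_in_filter => y _; congr (~~ _);
  apply/flatten_mapP/flatten_mapP=> -[z zs yz]; exists z => //; move: zs; rewrite mem_firsts.
rewrite -[RHS]cats0; congr (_ ++ _); apply/eqP.
rewrite -size_eq0 size_filter -leqn0 leqNgt -has_count -all_predC.
apply/allP => y; rewrite mem_firsts /= negbK => yx.
by apply/flatten_mapP; exists x.
Qed.

Section Profile.
Variable n : nat.

Definition profile (s : seq nat) : seq (nat * nat) :=
  [seq (x, minn n (count_mem x s)) | x <- firsts s].

Lemma unzip1_profile s : unzip1 (profile s) = firsts s.
Proof. by rewrite /unzip1 -map_comp map_id. Qed.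

Lemma profile_uniq s : uniq (unzip1 (profile s)).
Proof. by rewrite unzip1_profile firsts_uniq. Qed.

Lemma profile_cap s y : y \in profile s -> y.2 = minn n (count_mem y.1 s).
Proof. by case/mapP => x _ ->. Qed.

Lemma profileP s L U : firsts s = unzip1 L ++ U ->
  (forall y, y \in L -> minn n (count_mem y.1 s) = y.2) ->
  profile s = L ++ [seq (x, minn n (count_mem x s)) | x <- U].
Proof.
move=> sE Lcap; rewrite /profile sE map_cat; congr (_ ++ _).
rewrite -map_comp -[RHS]map_id; apply/eq_in_map => -[x e] /Lcap /= <- //.
Qed.

Lemma eq_profile s L : firsts s = unzip1 L ->
  (forall y, y \in L -> minn n (count_mem y.1 s) = y.2) -> profile s = L.
Proof. by move=> sE /(profileP (U := [::])); rewrite !cats0; apply. Qed.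

Lemma profile_exps s : (0 < n)%N -> exps_in n 1 (unzip2 (profile s)).
Proof.
move=> n0; rewrite /exps_in /unzip2 -map_comp all_map; apply/allP => x /=.
by rewrite mem_firsts -has_pred1 has_count leq_min n0 geq_minl andbT => ->.
Qed.

Definition canon (L : seq (nat * nat)) : seq nat := flatten [seq nseq y.2 y.1 | y <- L].

Lemma canon_cat L L' : canon (L ++ L') = canon L ++ canon L'.
Proof. by rewrite /canon map_cat flatten_cat. Qed.

Lemma profile_rcons_old s x L e L' : (0 < n)%N -> 
  profile s = L ++ (x, e) :: L' ->
  profile (rcons s x) = L ++ (x, minn n e.+1) :: L'.
Proof.
move=> n0 sE; have xs : x \in s.
  by rewrite -mem_firsts -unzip1_profile sE /unzip1 map_cat mem_cat inE eqxx orbT.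
have := profile_uniq s; rewrite sE /unzip1 map_cat /= uniq_catC /= => /andP[].
rewrite mem_cat negb_or => /andP[xL' xL] _.
apply: eq_profile; first by rewrite firsts_rcons xs -unzip1_profile sE /unzip1 !map_cat.
move=> [y k]; rewrite -cats1 count_cat /= addn0.
have capy z : z \in profile s -> z.2 = minn n (count_mem z.1 s) by apply: profile_cap.
have nx z (M : seq (nat * nat)) : z \in M -> x \notin unzip1 M -> (x == z.1) = false.
  by move=> zM; apply: contraNF => /eqP->; apply: map_f.
rewrite mem_cat inE => /or3P[yL|/eqP[-> ->]|yL].
- by rewrite (nx _ _ yL xL) addn0 -[k]/((y, k).2) (capy (y, k)) // sE mem_cat yL.
- rewrite eqxx; have := capy (x, e); rewrite sE mem_cat inE eqxx orbT /= => -> //.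
  by lia.
- by rewrite (nx _ _ yL xL') addn0 -[k]/((y, k).2) (capy (y, k)) // sE mem_cat inE yL !orbT.
Qed.

Lemma profile_rcons_new s x : (0 < n)%N -> x \notin s ->
  profile (rcons s x) = rcons (profile s) (x, 1%N).
Proof.
move=> n0 xs; apply: eq_profile.
  by rewrite firsts_rcons (negbTE xs) /unzip1 map_rcons -/(unzip1 _) unzip1_profile.
move=> y; rewrite mem_rcons inE -cats1 count_cat /= addn0 => /predU1P[->|yL] /=.
  by rewrite eqxx (count_memPn xs); apply/minn_idPr.
rewrite (profile_cap yL) (negbTE (contraNneq _ xs)) ?addn0 // => ->.
by rewrite -mem_firsts -unzip1_profile map_f.
Qed.
End Profile.

(** * Profiles decide the identities of the basis *)

Definition basis (n : nat) : set identity :=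
  [set (spow (letter 0) n.+1, spow (letter 0) n);
       (letter 0 * letter 1 * letter 0, letter 0 * letter 0 * letter 1)]%classic.

Lemma letters_spow i k : (0 < k)%N -> letters (spow (letter i) k) = nseq k i.
Proof.
elim: k => // -[//|k] IH _.
by rewrite -[spow _ _]/(letter i * spow (letter i) k.+1) letters_mul IH.
Qed.

Section Laws.
Variables (n : nat) (E : set identity).
Hypotheses (n_gt0 : (0 < n)%N) (basisE : forall e, basis n e -> deducible E e).

Lemma ded_basis sigma u v : basis n (u, v) ->
  ded E (letters (eval sigma u)) (letters (eval sigma v)).
Proof. by move=> /basisE/(deducible_subst sigma)/ded_letters. Qed.

Lemma ded_pow x : ded E (nseq n.+1 x) (nseq n x).
Proof.
have := ded_basis (fun=> letter x) (or_introl erefl).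
rewrite !letters_eval !letters_spow // !map_nseq.
have flat k : flatten (nseq k (letters (letter x))) = nseq k x.
  by elim: k => //= k ->.
by rewrite !flat.
Qed.

Lemma ded_xyx x s : ~~ nilp s -> ded E (x :: rcons s x) (x :: x :: s).
Proof.
move=> sn0; pose sigma i := if i is 0 then letter x else word_of s.
have := ded_basis sigma (or_intror erefl).
rewrite !eval_mul !eval_letter !letters_mul.
have -> : letters (sigma 1%N) = s by rewrite word_ofK.
by rewrite /= cats1.
Qed.

(** If [s] is nonempty, the [x] just before [s], then [s] and the final [x] form an instance of
    [xyx]; otherwise both sides are the same word. *)
Lemma ded_gather x e s : (0 < e)%N ->
  ded E (rcons (nseq e x ++ s) x) (nseq e.+1 x ++ s).
Proof.
case: e => // e _; case: (boolP (nilp s)) => [/nilP->|sn0].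
  rewrite !cats0 -cats1 -[X in _ ++ X]/(nseq 1 x) cat_nseq -[ncons _ _ _]cat_nseq.
  by rewrite -nseqD addn1; apply: dedxx.
have -> : rcons (nseq e.+1 x ++ s) x = nseq e x ++ x :: rcons s x.
  by rewrite -addn1 nseqD -catA rcons_cat.
have -> : nseq e.+2 x ++ s = nseq e x ++ x :: x :: s.
  by rewrite -addn2 nseqD -catA.
by apply: ded_cat (dedxx _ _) (ded_xyx _ sn0).
Qed.

(** Induction on the last letter. A new letter opens a block at the end; an old one is gathered into
    its block, where the power law absorbs it once the exponent has reached [n]. *)
Lemma ded_canon s : ded E s (canon (profile n s)).
Proof.
elim/last_ind: s => [|s x IH]; first exact: dedxx.
have IHx : ded E (rcons s x) (rcons (canon (profile n s)) x).
  by rewrite -!cats1; apply: ded_cat IH (dedxx _ _).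
apply: (ded_tr IHx); have [xs|xs] := boolP (x \in s); last first.
  rewrite profile_rcons_new // -!cats1 canon_cat; exact: dedxx.
have /mapP[[y e] yin /= xy] : x \in unzip1 (profile n s).
  by rewrite unzip1_profile mem_firsts.
have e0 : (0 < e <= n)%N.
  have := profile_exps s n_gt0; rewrite /exps_in all_map => /allP/(_ _ yin).
  by [].
move: yin; rewrite -{}xy => yin.
have [L [L' sE]] : exists L L', profile n s = L ++ (x, e) :: L'.
  by case/splitPr: yin => L L'; exists L, L'.
rewrite (profile_rcons_old n_gt0 sE) sE !canon_cat rcons_cat; apply: ded_cat; first exact: dedxx.
apply: (ded_tr (ded_gather _ _ _)); first by case/andP: e0.
apply: ded_cat => /=; last exact: dedxx.
have [->|en] := eqVneq e n; last first.
  have -> : minn n e.+1 = e.+1 by lia.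
  exact: dedxx.
have -> : minn n n.+1 = n by lia.
exact: ded_pow.
Qed.

Lemma ded_profile s t : profile n s = profile n t -> ded E s t.
Proof. by move=> st; apply: (ded_tr (ded_canon s)); rewrite st; apply/dedC/ded_canon. Qed.
End Laws.

(** * Realized keys *)

Lemma exists_fresh (s : seq nat) : exists x, x \notin s.
Proof.
exists (sumn s).+1; apply/negP.
suff le_sumn y : y \in s -> (y <= sumn s)%N by move=> /le_sumn; rewrite ltnn.
elim: s => //= x s IH; rewrite inE => /predU1P[->|/IH ys]; first exact: leq_addr.
exact: leq_trans ys (leq_addl _ _).
Qed.

Lemma split_map (A B : eqType) (f : A -> B) s s1 b s2 : map f s = s1 ++ b :: s2 ->
  exists s1' a s2', [/\ s = s1' ++ a :: s2', map f s1' = s1, f a = b & map f s2' = s2].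
Proof.
elim: s s1 => [|a s IH] [|b1 s1] //= [].
  by move=> <- <-; exists [::], a, s.
move=> <- /IH[s1' [a' [s2' [-> <- <- <-]]]].
by exists (a :: s1'), a', s2'.
Qed.

Lemma unzip_inj (A B : Type) (s t : seq (A * B)) :
  unzip1 s = unzip1 t -> unzip2 s = unzip2 t -> s = t.
Proof. by move=> s1 s2; rewrite -[s]zip_unzip -[t]zip_unzip s1 s2. Qed.

(** * Inserting a fresh letter after a given one *)

Section Insertion.
Variables (n z e fr c : nat).
Hypotheses (ec : (e <= c)%N) (cn : (c <= n)%N) (frz : fr != z).

Let tau i := if i == z then [:: z; fr] else [:: i].
Let dup (s : seq nat) := flatten (map tau s).

(** The substitution gives [fr] the exponent [e] of [z], and the right factor raises it to [c]. *)
Definition insert_word (s : seq nat) : seq nat := dup s ++ nseq (c - e) fr.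

Definition insert_profile (L : seq (nat * nat)) : seq (nat * nat) :=
  flatten [seq if y.1 == z then [:: y; (fr, c)] else [:: y] | y <- L].

Lemma insert_profile_cat L L' :
  insert_profile (L ++ L') = insert_profile L ++ insert_profile L'.
Proof. by rewrite /insert_profile map_cat flatten_cat. Qed.

Lemma insert_profile_id L : z \notin unzip1 L -> insert_profile L = L.
Proof.
elim: L => //= y L IH; rewrite inE negb_or eq_sym => /andP[/negbTE yz /IH{2}<-].
by rewrite /insert_profile /= yz.
Qed.

Lemma insert_profile_split L L' : uniq (unzip1 (L ++ (z, e) :: L')) ->
  insert_profile (L ++ (z, e) :: L') = L ++ (z, e) :: (fr, c) :: L'.
Proof.
rewrite /unzip1 map_cat uniq_catC /= mem_cat negb_or => /andP[/andP[zL' zL] _].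
rewrite insert_profile_cat insert_profile_id // -cat1s insert_profile_cat.
by rewrite (insert_profile_id zL') /insert_profile /= eqxx.
Qed.

Lemma mem_insert_profile L y : y \in insert_profile L ->
  y \in L \/ y = (fr, c) /\ exists2 y', y' \in L & y'.1 = z.
Proof.
case/flatten_mapP => y' y'L; case: eqP => y'z; rewrite !inE; last first.
  by move=> /eqP->; left.
by case/orP=> /eqP->; [left | right; split=> //; exists y'].
Qed.

Lemma unzip1_insert_profile L : unzip1 (insert_profile L) = dup (unzip1 L).
Proof.
elim: L => //= y L IH; rewrite -cat1s insert_profile_cat /unzip1 map_cat.
rewrite -/(unzip1 (insert_profile L)) IH /dup /= /insert_profile /tau /= cats0.
by case: eqP => [<-|].
Qed.

Lemma mem_dup s y : y \in dup s = (y \in s) || (y == fr) && (z \in s).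
Proof.
apply/flatten_mapP/orP=> [[i si]|[sy|/andP[/eqP-> sz]]].
- rewrite /tau; case: eqP => [iz|_]; rewrite !inE; last by move=> /eqP->; left.
  by case/orP=> /eqP->; [left; rewrite -iz | right; rewrite eqxx -iz].
- by exists y => //; rewrite /tau; case: eqP => [->|]; rewrite !inE eqxx.
- by exists z => //; rewrite /tau eqxx !inE eqxx orbT.
Qed.

Lemma dup_uniq s : uniq s -> fr \notin s -> uniq (dup s).
Proof.
elim: s => //= x s IH /andP[xs us]; rewrite inE negb_or => /andP[frx frs].
have := mem_dup s; rewrite /dup /= cat_uniq -/(dup s) IH // andbT => memE.
rewrite {1 2}/tau; case: eqP => [xz|xz] /=.
  rewrite !inE eq_sym frz /=; apply/hasPn => y.
  rewrite memE !inE -xz (negbTE xs) andbF orbF => ys.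
  by apply/norP; split; [apply: contraNneq xs => <- | apply: contraNneq frs => <-].
apply/hasPn => y; rewrite memE !inE => /orP[ys|/andP[/eqP-> _]] //.
by apply: contraNneq xs => <-.
Qed.

Lemma count_dup s y : y != fr -> count_mem y (dup s) = count_mem y s.
Proof.
move=> yfr; rewrite /dup; elim: s => //= x s IH.
rewrite count_cat IH; congr (_ + _)%N; rewrite /tau; have [xz|_] := eqVneq x z => /=.
  by rewrite xz [fr == y]eq_sym (negbTE yfr) !addn0.
by rewrite addn0.
Qed.

Lemma count_dup_fresh s : fr \notin s -> count_mem fr (dup s) = count_mem z s.
Proof.
rewrite /dup; elim: s => //= x s IH; rewrite inE negb_or => /andP[frx /IH].
rewrite count_cat => ->; congr (_ + _)%N; rewrite /tau; have [xz|_] := eqVneq x z => /=.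
  by rewrite eq_sym (negbTE frz) eqxx.
by rewrite eq_sym (negbTE frx).
Qed.

(** [U'] accounts for the factor of letters [fr] on the right, which can bring a new letter only if
    [z] is absent from [s]. *)
Lemma firsts_insert_word s L U : fr \notin s -> firsts s = unzip1 L ++ U ->
  exists U', firsts (insert_word s) = unzip1 (insert_profile L) ++ dup U ++ U' /\
    (z \in s -> U' = [::]).
Proof.
move=> frs sE; exists [seq x <- firsts (nseq (c - e) fr) | x \notin dup s].
have us := firsts_uniq s; rewrite firsts_cat firsts_flatten -/(dup _) firsts_id; last first.
  by apply: dup_uniq => //; rewrite mem_firsts.
rewrite sE /dup map_cat flatten_cat -!/(dup _) -unzip1_insert_profile -catA.
split=> // zs; rewrite -(filter_pred0 (firsts (nseq (c - e) fr))).
apply: eq_in_filter => y; rewrite mem_firsts mem_nseq => /andP[_ /eqP->].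
by rewrite mem_dup zs eqxx orbT.
Qed.

Lemma insert_word_cap s L : fr \notin s ->
  (forall y, y \in L -> minn n (count_mem y.1 s) = y.2) ->
  (forall y, y \in L -> y.1 \in s /\ (y.1 = z -> y.2 = e)) ->
  forall y, y \in insert_profile L -> minn n (count_mem y.1 (insert_word s)) = y.2.
Proof.
move=> frs cap Lz y /mem_insert_profile[yL|[-> [y' y'L y'z]]].
  have yfr : y.1 != fr by apply: contraNneq frs => <-; case: (Lz y yL).
  rewrite count_cat count_dup // count_nseq /= eq_sym (negbTE yfr) mul0n addn0.
  exact: cap.
have := cap _ y'L; rewrite y'z (Lz y' y'L).2 //= => capz.
(* If [e] is below [n], it is the exact count of [z]; if it equals [n], then so does [c], and the
   cap gives [n] again. *)
by rewrite count_cat count_dup_fresh // count_nseq /= eqxx mul1n; lia.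
Qed.
End Insertion.

(** * Keys realized by a theory: upward closure and renaming *)

Section Realize.
Variables (n : nat) (E : set identity).
Hypotheses (n_gt0 : (0 < n)%N) (basisE : forall e, basis n e -> deducible E e).

(* The letter [x] that follows the common part [P] in [s] is either the first
   letter of [R] or, when [R] is empty, absent from [t]. *)
Definition witness (s t : seq nat) (P Q R : seq (nat * nat)) (x a : nat) : Prop :=
  [/\ ded E s t, profile n t = P ++ Q ++ R,
      exists U, profile n s = P ++ (x, a) :: U,
      x \notin unzip1 (P ++ Q) & head x (unzip1 R) = x].

(** The letters are forgotten: the length of [p] tells where the common part ends, and that of [q]
    where [x] stands in [t]. *)
Definition realized (p q r : seq nat) (a : nat) : Prop :=
  exists s t P Q R x,
    [/\ witness s t P Q R x a, unzip2 P = p, unzip2 Q = q & unzip2 R = r].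

(** Both words undergo the same substitution and the same right multiplication, so the deduction
    survives. Since [fr] differs from [x], the exponent of [x] in the left-hand word is
    unchanged. *)
Lemma witness_insert s t P Q R x a z e c :
  witness s t P Q R x a -> (z, e) \in P ++ Q ++ R -> (e <= c <= n)%N ->
  exists fr s' t', witness s' t' (insert_profile z fr c P)
    (insert_profile z fr c Q) (insert_profile z fr c R) x a.
Proof.
move=> [dst tE [U sE] xPQ xR] ze /andP[ec cn].
have [fr] := exists_fresh (s ++ t); rewrite mem_cat negb_or => /andP[frs frt].
have in_t y : y \in P ++ Q ++ R -> y.1 \in t.
  by move=> yL; rewrite -mem_firsts -(unzip1_profile n) tE map_f.
have in_s y : y \in P ++ (x, a) :: U -> y.1 \in s.
  by move=> yL; rewrite -mem_firsts -(unzip1_profile n) sE map_f.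
have zt : z \in t := in_t _ ze.
have frz : fr != z by apply: contraNneq frt => ->.
have xfr : x != fr.
  by apply: contraNneq frs => <-; apply: (in_s (x, a)); rewrite mem_cat inE eqxx orbT.
have capt y : y \in P ++ Q ++ R -> minn n (count_mem y.1 t) = y.2.
  by rewrite -tE => /profile_cap.
have caps y : y \in P ++ (x, a) :: U -> minn n (count_mem y.1 s) = y.2.
  by rewrite -sE => /profile_cap.
have exp_z y : y \in P ++ Q ++ R -> y.1 = z -> y.2 = e.
  by move=> yL yz; rewrite -(capt y yL) yz -[RHS]/((z, e).2) -(capt _ ze).
exists fr, (insert_word z e fr c s), (insert_word z e fr c t); split.
- rewrite /insert_word; apply: ded_cat (dedxx _ _); apply: ded_map dst => i.
  by case: eqP.
- rewrite -!insert_profile_cat; apply: eq_profile; last first.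
    by apply: insert_word_cap => // y yL; split; [apply: in_t | apply: exp_z].
  have [|U' [-> ->//]] := @firsts_insert_word z e fr c frz t (P ++ Q ++ R) [::] frt.
    by rewrite cats0 -tE unzip1_profile.
  by rewrite /= cats0.
- have [|U' [sE' _]] := @firsts_insert_word z e fr c frz s P (x :: unzip1 U) frs.
    by rewrite -(unzip1_profile n) sE /unzip1 map_cat.
  (* If [z] is [x], its image is [x fr], so [x] still comes directly after the common part. *)
  have [V firstV] : exists V, firsts (insert_word z e fr c s) =
      unzip1 (rcons (insert_profile z fr c P) (x, a)) ++ V.
    rewrite sE' /unzip1 map_rcons /=.
    by case: eqP => [->|_]; eexists; rewrite cat_rcons.
  eexists; rewrite -cat_rcons; apply: (profileP firstV) => y.
  rewrite mem_rcons inE => /predU1P[->|] /=.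
    rewrite count_cat count_dup // count_nseq /= eq_sym (negbTE xfr) mul0n addn0.
    by apply: (caps (x, a)); rewrite mem_cat inE eqxx orbT.
  apply: (insert_word_cap ec cn frz frs) => {}y yP.
    by apply: caps; rewrite mem_cat yP.
  by split; [apply: in_s | apply: exp_z]; rewrite mem_cat yP.
- rewrite -insert_profile_cat; apply/mapP => -[y + xy].
  rewrite xy in xfr xPQ; case/mem_insert_profile=> [yPQ|[yfr _]].
    by move: xPQ; rewrite map_f.
  by rewrite yfr eqxx in xfr.
- by case: (R) xR => [|[y k] R'] //= ->; rewrite /insert_profile /=; case: ifP.
Qed.

(** One insertion at a time, first in [P], then in [Q], then in [R]. The letters of a profile are
    distinct, so inserting after a letter of one segment leaves the other two alone. *)
Lemma realized_gap p p' q q' r r' a : realized p q r a ->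
  gap n p p' -> gap n q q' -> gap n r r' -> realized p' q' r' a.
Proof.
move=> + gp gq gr.
have out s t P Q R x b : witness s t P Q R x b ->
    forall L M N z, P ++ Q ++ R = L ++ M ++ N -> z \in unzip1 M ->
    [/\ z \notin unzip1 L, uniq (unzip1 M) & z \notin unzip1 N].
  case=> _ tE _ _ _ L M N z PQR zM; have := profile_uniq n t.
  rewrite tE PQR /unzip1 !map_cat !cat_uniq => /and3P[_ disL /and3P[uM disN _]].
  split=> //; first by apply: (contraNN _ disL) => zL; apply/hasP; exists z; rewrite ?mem_cat ?zM.
  by apply: (contraNN _ disN) => zN; apply/hasP; exists z.
move=> real0.
have real1 : realized p' q r a.
  elim: gp => {p'}// s1 e c s2 _ [s [t [P [Q [R [x [w pE qE rE]]]]]]] ec.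
  have [P1 [[z e'] [P2 [PE P1E /= ee P2E]]]] := split_map pE; subst e'.
  have zP : (z, e) \in P by rewrite PE mem_cat inE eqxx orbT.
  have [|fr [s' [t' w']]] := witness_insert (z := z) (e := e) w _ ec.
    by rewrite mem_cat zP.
  have [//|_ uP] := out _ _ _ _ _ _ _ w [::] P (Q ++ R) z _ (map_f _ zP).
  rewrite /unzip1 map_cat mem_cat negb_or => /andP[zQ zR].
  exists s', t'; do 4 eexists; split; [exact: w'| | |].
  - by move: uP; rewrite PE => /insert_profile_split->; rewrite /unzip2 map_cat /= P1E P2E.
  - by rewrite insert_profile_id.
  - by rewrite insert_profile_id.
have real2 : realized p' q' r a.
  elim: gq => {q'}// s1 e c s2 _ [s [t [P [Q [R [x [w pE qE rE]]]]]]] ec.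
  have [P1 [[z e'] [P2 [PE P1E /= ee P2E]]]] := split_map qE; subst e'.
  have zQ : (z, e) \in Q by rewrite PE mem_cat inE eqxx orbT.
  have [|fr [s' [t' w']]] := witness_insert (z := z) (e := e) w _ ec.
    by rewrite !mem_cat zQ orbT.
  have [//|zP uQ zR] := out _ _ _ _ _ _ _ w P Q R z _ (map_f _ zQ).
  exists s', t'; do 4 eexists; split; [exact: w'| | |].
  - by rewrite insert_profile_id.
  - by move: uQ; rewrite PE => /insert_profile_split->; rewrite /unzip2 map_cat /= P1E P2E.
  - by rewrite insert_profile_id.
elim: gr => {r'}// s1 e c s2 _ [s [t [P [Q [R [x [w pE qE rE]]]]]]] ec.
have [P1 [[z e'] [P2 [PE P1E /= ee P2E]]]] := split_map rE; subst e'.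
have zR : (z, e) \in R by rewrite PE mem_cat inE eqxx orbT.
have [|fr [s' [t' w']]] := witness_insert (z := z) (e := e) w _ ec.
  by rewrite !mem_cat zR !orbT.
have [|+ uR _] := out _ _ _ _ _ _ _ w (P ++ Q) R [::] z _ (map_f _ zR).
  by rewrite cats0 catA.
rewrite /unzip1 map_cat mem_cat negb_or => /andP[zP zQ].
exists s', t'; do 4 eexists; split; [exact: w'| | |].
- by rewrite insert_profile_id.
- by rewrite insert_profile_id.
- by move: uR; rewrite PE => /insert_profile_split->; rewrite /unzip2 map_cat /= P1E P2E.
Qed.

(** Renaming turns the right-hand word of the realizing pair into one with the profile of [t], to
    which [t] is then equivalent; the renamed left-hand word is the desired [s]. *)
Lemma realized_match P Q R x a t :
  realized (unzip2 P) (unzip2 Q) (unzip2 R) a -> profile n t = P ++ Q ++ R ->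
  x \notin unzip1 (P ++ Q) -> head x (unzip1 R) = x ->
  exists2 s, ded E s t & exists U, profile n s = P ++ (x, a) :: U.
Proof.
move=> [s0 [t0 [P0 [Q0 [R0 [x0 [w pE qE rE]]]]]]] tE xPQ xR.
case: w => dst t0E [U s0E] x0PQ x0R.
pose T := P ++ Q ++ R; pose T0 := P0 ++ Q0 ++ R0.
have [fr] := exists_fresh (x :: unzip1 T); rewrite inE negb_or => /andP[frx frT].
(* Letters are matched by their places in the two profiles, and the default value sends all others
   to [fr]. The special value of [f] at [x0] serves the case of empty [R0]; otherwise it agrees with
   [g]. *)
pose g y := nth fr (unzip1 T) (index y (unzip1 T0)).
pose f y := if y == x0 then x else g y.
have uT : uniq (unzip1 T) by rewrite -[T]tE profile_uniq.
have uT0 : uniq (unzip1 T0) by rewrite -[T0]t0E profile_uniq.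
have sz (L L' : seq (nat * nat)) : unzip2 L = unzip2 L' -> size L = size L'.
  by move=> /(congr1 size); rewrite !size_map.
have sizeT : size (unzip1 T) = size (unzip1 T0).
  by rewrite !size_map !size_cat (sz _ _ pE) (sz _ _ qE) (sz _ _ rE).
have R_x0 : R0 != [::] -> x0 \in unzip1 T0 /\ g x0 = x.
  case R0E: R0 x0R rE => [//|[y k] R0'] /= yx; case RE: R xR => [//|[y' k'] R'] /= yx' _ _.
  have T0E : unzip1 T0 = unzip1 (P0 ++ Q0) ++ x0 :: unzip1 R0'.
    by rewrite /T0 R0E catA /unzip1 map_cat /= yx.
  have TE : unzip1 T = unzip1 (P ++ Q) ++ x :: unzip1 R'.
    by rewrite /T RE catA /unzip1 map_cat /= yx'.
  split; first by rewrite T0E mem_cat inE eqxx orbT.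
  rewrite /g T0E index_cat (negbTE x0PQ) /= eqxx addn0 TE nth_cat !size_map !size_cat.
  by rewrite (sz _ _ pE) (sz _ _ qE) ltnn subnn.
have mapg : map g (unzip1 T0) = unzip1 T.
  apply: (@eq_from_nth _ fr) => [|i]; rewrite size_map // => iT.
  by rewrite (nth_map fr) // /g index_uniq.
have fg y : y \in unzip1 T0 -> f y = g y.
  rewrite /f; case: eqP => // -> x0T; apply/esym/(R_x0 _).2.
  by apply: contraTneq x0T => R0E; rewrite /T0 R0E cats0.
have mapf : map f (unzip1 T0) = unzip1 T.
  by rewrite -mapg; apply/eq_in_map.
have xT : x \in unzip1 T -> x0 \in unzip1 T0.
  move=> xT; apply: (R_x0 _).1; apply: contraTneq xT => R0E.
  have -> : T = P ++ Q; last by [].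
  move: rE; rewrite R0E /T => /esym; case: (R) => // _; by rewrite cats0.
have f_T y : y \in unzip1 T0 -> f y \in unzip1 T by move=> yT; rewrite -mapf map_f.
have f_out y : y \notin unzip1 T0 -> y != x0 -> f y = fr.
  move=> yT yx; rewrite /f (negbTE yx) /g nth_default // sizeT leqNgt index_mem //.
have g_inj y y' : y \in unzip1 T0 -> y' \in unzip1 T0 -> g y' = g y -> y' = y.
  move=> yT y'T /eqP; rewrite nth_uniq ?sizeT ?index_mem // => /eqP.
  exact: index_inj.
(* The remaining letters of [s0] may collapse to [fr], since only [x0] and the letters of [t0] must
   keep their counts. *)
have f_inj y : y \in x0 :: unzip1 T0 -> forall y', f y' = f y -> y' = y.
  move=> yin y' fy; apply/eqP; apply: contraT => y'y.
  have fx0 : f x0 = x by rewrite /f eqxx.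
  have [yT|yT] := boolP (y \in unzip1 T0).
    have [y'T|y'T] := boolP (y' \in unzip1 T0).
      by move: fy y'y; rewrite !fg // => /g_inj-> //; rewrite eqxx.
    have y'x : y' != x0.
      apply: contraNneq y'T => y'E; rewrite y'E; apply: xT.
      by rewrite -fx0 -y'E fy f_T.
    by move: frT; rewrite -(f_out _ y'T y'x) fy f_T.
  move: yin; rewrite inE (negbTE yT) orbF => /eqP yx0; subst y.
  have [y'T|y'T] := boolP (y' \in unzip1 T0).
    by case/negP: yT; apply: xT; rewrite -fx0 -fy f_T.
  by move: frx; rewrite -(f_out _ y'T y'y) fy fx0 eqxx.
have count_f y s : y \in x0 :: unzip1 T0 -> count_mem (f y) (map f s) = count_mem y s.
  move=> yin; rewrite count_map; apply: eq_count => y' /=.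
  by apply/eqP/eqP=> [|->//]; apply: f_inj.
have mapE L0 L : map f (unzip1 L0) = unzip1 L -> unzip2 L0 = unzip2 L ->
    L = [seq (f y.1, y.2) | y <- L0].
  move=> L1 L2; apply: unzip_inj; rewrite /unzip1 /unzip2 -?map_comp.
    by rewrite -/(unzip1 _) -L1 -map_comp.
  by rewrite -/(unzip2 _) -L2.
have PE : P = [seq (f y.1, y.2) | y <- P0].
  apply: mapE => //; have := congr1 (take (size P0)) mapf.
  rewrite /unzip1 -!map_take /T /T0 !take_size_cat ?(sz _ _ pE) //.
have TE : T = [seq (f y.1, y.2) | y <- T0].
  by apply: mapE => //; rewrite /T /T0 /unzip2 !map_cat -!/(unzip2 _) pE qE rE.
have firsts_f s : firsts (map f s) = firsts (map f (firsts s)).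
  by rewrite -[map f s]flatten_map1 firsts_flatten flatten_map1.
exists (map f s0).
  have dst' : ded E (map f s0) (map f t0).
    by rewrite -[map f s0]flatten_map1 -[map f t0]flatten_map1; apply: ded_map.
  apply: (ded_tr dst'); apply: (ded_profile n_gt0 basisE); rewrite tE; apply: eq_profile.
    by rewrite firsts_f -(unzip1_profile n t0) t0E -/T0 mapf firsts_id.
  rewrite -/T TE => _ /mapP[y yT0 ->] /=; rewrite count_f ?inE ?map_f ?orbT //.
  by rewrite -(profile_cap (n := n)) ?t0E.
have mapP0 : map f (unzip1 P0) = unzip1 P.
  by rewrite PE /unzip1 -!map_comp.
have [V firstV] : exists V, firsts (map f s0) = unzip1 (rcons P (x, a)) ++ V.
  rewrite firsts_f -(unzip1_profile n s0) s0E {1}/unzip1 map_cat -/(unzip1 P0) map_cat mapP0.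
  rewrite /= {1}/f eqxx -cat_rcons firsts_cat firsts_id; last first.
    move: uT xPQ; rewrite /T /unzip1 !map_cat cat_uniq rcons_uniq mem_cat negb_or.
    by move=> /and3P[-> _ _] /andP[->].
  by rewrite /unzip1 map_rcons; eexists.
eexists; rewrite -cat_rcons; apply: (profileP firstV) => y.
have cap0 y0 : y0 \in P0 ++ (x0, a) :: U -> minn n (count_mem y0.1 s0) = y0.2.
  by rewrite -s0E => /profile_cap.
rewrite mem_rcons inE => /predU1P[->|] /=.
  have -> : x = f x0 by rewrite /f eqxx.
  rewrite count_f ?inE ?eqxx //.
  by apply: (cap0 (x0, a)); rewrite mem_cat inE eqxx orbT.
rewrite PE => /mapP[y0 y0P ->] /=; rewrite count_f.
  by apply: cap0; rewrite mem_cat y0P.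
by rewrite inE /T0 /unzip1 map_cat mem_cat map_f ?orbT.
Qed.

(* Substituting [w ^ n] for the letters outside [P] makes the left-hand side
   absorb every letter of [w]. *)
Lemma ded_absorb s t P y b U : ded E s t -> profile n t = P ->
  profile n s = P ++ (y, b) :: U -> forall w, ded E t (t ++ w).
Proof.
move=> dst tE sE w; have [/nilP->|wn0] := boolP (nilp w).
  by rewrite cats0; apply: dedxx.
pose wn := flatten (nseq n w).
have wn_n0 : ~~ nilp wn by rewrite /wn; case: (n) n_gt0 => //= m _; case: (w) wn0.
pose tau i := if i \in t then [:: i] else wn.
have taut : flatten (map tau t) = t.
  have {2}-> : t = flatten [seq [:: i] | i <- t] by rewrite flatten_map1 map_id.
  by congr flatten; apply/eq_in_map => i it; rewrite /tau it.
have ys : y \in s.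
  by rewrite -mem_firsts -(unzip1_profile n) sE /unzip1 map_cat mem_cat inE eqxx orbT.
have yt : y \notin t.
  rewrite -mem_firsts -(unzip1_profile n) tE.
  have := profile_uniq n s; rewrite sE /unzip1 map_cat uniq_catC /= mem_cat negb_or.
  by case/andP=> /andP[].
have dtau : ded E (flatten (map tau s)) t.
  by rewrite -[X in ded _ _ X]taut; apply: ded_map dst => i; rewrite /tau; case: ifP.
(* The letter [y] of [s] is absent from [t], so the image of [s] contains a copy of [wn].
   Multiplying this image by [w] therefore preserves its profile. *)
have full z : z \in w -> (n <= count_mem z (flatten (map tau s)))%N.
  move=> zw; apply: (@leq_trans (count_mem z wn)).
    rewrite /wn; elim: (n) => //= m IH; rewrite count_cat -add1n leq_add //.
    by rewrite -has_count has_pred1.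
  elim: s ys {dst sE dtau} => //= i s IH; rewrite inE count_cat => /predU1P[<-|/IH].
    by rewrite /tau (negbTE yt) leq_addr.
  by move/leq_trans; apply; apply: leq_addl.
apply: (ded_tr (dedC dtau)); apply: ded_tr (ded_cat dtau (dedxx E w)).
apply: (ded_profile n_gt0 basisE).
have firstE : firsts (flatten (map tau s) ++ w) = firsts (flatten (map tau s)).
  rewrite firsts_cat -[RHS]cats0; congr (_ ++ _).
  rewrite -(filter_pred0 (firsts w)); apply: eq_in_filter => z; rewrite mem_firsts => /full.
  by move=> zn; apply/negbTE; rewrite negbK -has_pred1 has_count (leq_trans n_gt0).
rewrite /profile firstE; apply: eq_map => z; congr (_, _); rewrite count_cat.
have [/full zn|/count_memPn->] := boolP (z \in w); last by rewrite addn0.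
by rewrite !(minn_idPl _) // (leq_trans zn) // leq_addr.
Qed.
End Realize.

(* Sorting [t] towards [s]: a key realized in [E] replaces [t] by a word that
   has a longer initial segment in common with [s]. *)
Lemma ded_of_realized n (E F : set identity) : (0 < n)%N ->
  (forall e, basis n e -> deducible E e) ->
  (forall e, E e -> deducible F e) ->
  (forall p q r a, realized n F p q r a -> realized n E p q r a) ->
  forall s t, ded F s t -> ded E s t.
Proof.
move=> n0 basisE EF FE s t.
suff main U P V : profile n s = P ++ U -> profile n t = P ++ V -> ded F s t -> ded E s t.
  exact: main (profile n s) [::] (profile n t) erefl erefl.
elim: U P V t => [|[x a] U IH] P V t sE tE dst.
  rewrite cats0 in sE; case: V tE => [|[y b] V] tE.
    by apply: (ded_profile n0 basisE); rewrite sE tE cats0.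
  (* Here [s] has run out of letters while [t] has more. With the roles exchanged, a realized key
     makes [s] absorb every word, in particular the rest of [t]. *)
  have yP : y \notin unzip1 (P ++ [::]).
    have := profile_uniq n t; rewrite tE cats0 /unzip1 map_cat uniq_catC /= mem_cat negb_or.
    by case/andP=> /andP[].
  have [||s' ds' [V' s'E]] := realized_match n0 basisE (P := P) (Q := [::])
      (R := [::]) (x := y) (a := b) (t := s) _ _ yP erefl.
  - apply: FE; exists t, s, P, [::], [::], y; split=> //; split=> //.
    + exact: dedC.
    + by rewrite !cats0.
    + by exists V.
  - by rewrite !cats0.
  apply: (ded_tr (ded_absorb n0 basisE ds' sE s'E (canon ((y, b) :: V)))).
  apply: (ded_tr (ded_cat (ded_canon n0 basisE s) (dedxx _ _))).
  by apply: dedC; rewrite sE -canon_cat -tE; apply: ded_canon.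
(* If [x] is absent from [V], [index] returns the size of [V], so [R] is empty. *)
pose Q := take (index x (unzip1 V)) V; pose R := drop (index x (unzip1 V)) V.
have VE : V = Q ++ R by rewrite cat_take_drop.
have xP : x \notin unzip1 P.
  have := profile_uniq n s; rewrite sE /unzip1 map_cat uniq_catC /= mem_cat negb_or.
  by case/andP=> /andP[].
have xPQ : x \notin unzip1 (P ++ Q).
  rewrite /unzip1 map_cat mem_cat negb_or xP /= /Q map_take -/(unzip1 V).
  by apply/negP => /index_ltn; rewrite ltnn.
have xR : head x (unzip1 R) = x.
  rewrite -nth0 /R /unzip1 map_drop nth_drop addn0 -/(unzip1 V).
  have [xV|xV] := boolP (x \in unzip1 V); first exact: nth_index.
  by rewrite nth_default // memNindex.
have tE' : profile n t = P ++ Q ++ R by rewrite tE VE.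
have [|s' ds' [V' s'E]] := realized_match n0 basisE (a := a) _ tE' xPQ xR.
  by apply: FE; exists s, t, P, Q, R, x; split=> //; split=> //; exists U.
apply: (ded_tr _ ds'); apply: (IH (rcons P (x, a)) V').
- by rewrite sE cat_rcons.
- by rewrite s'E cat_rcons.
- exact: ded_tr dst (ded_sub EF (dedC ds')).
Qed.

Definition identities_of (l : seq (seq nat * seq nat)) : set identity :=
  fun e => exists2 c, c \in l & e = (word_of c.1, word_of c.2).

(** One identity is chosen for each of finitely many keys that lie below all keys realized in [F];
    upward closure then makes all of these realized in the generated theory. *)
Theorem finitely_based n (F : set identity) : (0 < n)%N ->
  (forall e, basis n e -> deducible F e) ->
  exists l, forall e,
    deducible F e <-> deducible (basis n `|` identities_of l)%classic e.
Proof.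
move=> n0 basisF.
pose K := (seq nat * seq nat * seq nat * nat)%type.
pose D (k : K) := ((exps_in n 1 k.1.1.1 /\ exps_in n 1 k.1.1.2) /\ exps_in n 1 k.1.2)
  /\ (k.2 <= n)%N.
pose le (k k' : K) := ((gap n k.1.1.1 k'.1.1.1 /\ gap n k.1.1.2 k'.1.1.2) /\
  gap n k.1.2 k'.1.2) /\ k.2 = k'.2.
pose real E (k : K) := realized n E k.1.1.1 k.1.1.2 k.1.2 k.2.
have wqoK : wqo D le.
  have wqoG := @gap_wqo n 1%N.
  exact (wqo_prod (wqo_prod (wqo_prod wqoG wqoG) wqoG) (@wqo_leq n)).
have realD k : real F k -> D k.
  case: k => -[[p q] r] a [s [t [P [Q [R [x [w /= pE qE rE]]]]]]].
  case: w => _ tE [U sE] _ _; rewrite /D /= -pE -qE -rE.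
  have := profile_exps t n0; rewrite tE /unzip2 !map_cat /exps_in !all_cat.
  case/and3P=> -> -> ->; split=> //.
  have := profile_exps s n0; rewrite sE /unzip2 map_cat /exps_in all_cat /=.
  by case/and3P=> _ /andP[].
have [ks ksF ksmin] := wqo_finite_basis wqoK realD.
have /choice[pick pickP] k : exists c, real F k -> ded F c.1 c.2 /\
    forall E, ded E c.1 c.2 -> real E k.
  have [[s [t [P [Q [R [x [[dst tE sE xPQ xR] pE qE rE]]]]]]]|nreal] := pselect (real F k).
    by exists (s, t) => _; split=> // E dE; exists s, t, P, Q, R, x.
  by exists ([::], [::]).
exists (map pick ks); set E := (_ `|` _)%classic.
have EF e : E e -> deducible F e.
  case=> [/basisF //|[_ /mapP[k kin ->] ->]].
  by case: (pickP k (ksF _ kin)) => -[].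
have basisE e : basis n e -> deducible E e.
  by move=> be; apply: deducible_ax; left.
move=> e; split=> [|dE]; last by apply: deducible_sub dE.
case: e => u v /ded_letters duv; apply/ded_letters.
apply: (ded_of_realized n0 basisE EF) duv => p q r a.
move=> /(ksmin (p, q, r, a))[[[[p' q'] r'] a'] kin [[[/= gp gq] gr] <-]].
apply: realized_gap gp gq gr; have [[nilF _]] := pickP _ (ksF _ kin); apply.
split=> //; apply: deducible_ax; right.
by exists (pick (p', q', r', a')) => //; apply: map_f.
Qed.

(** * Varieties and identities *)

Definition models (E : set identity) (S : semigroupType) : Prop :=
  inhabited S /\ forall e, E e -> satisfies S e.

Lemma morph_eval (S T : semigroupType) (f : {multiplicative S -> T}) phi w :
  f (eval phi w) = eval (fun i => f (phi i)) w.
Proof. by elim/word_ind: w => // w i IH; rewrite !eval_mul gmulfM IH. Qed.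

Lemma eval_direct_product (I : Type) (F : I -> semigroupType)
    (phi : nat -> direct_product F) w i :
  eval phi w i = eval (fun k => phi k i) w.
Proof. by elim/word_ind: w => // w k IH; rewrite !eval_mul -IH. Qed.

Lemma satisfies_deducible (S : semigroupType) (E : set identity) :
  (forall e, E e -> satisfies S e) -> forall e, deducible E e -> satisfies S e.
Proof.
move=> SE e; elim=> {e} [e sigma /SE Se|u|u v _ IH|u v w _ IH _ IH'|u u' v v' _ IH _ IH'] phi.
- by rewrite !eval_eval; apply: Se.
- by [].
- exact/esym/IH.
- exact: etrans (IH phi) (IH' phi).
- by rewrite /= !eval_mul; congr (_ * _); [apply: IH | apply: IH'].
Qed.

Lemma models_variety E : variety (models E).
Proof.
split=> [S []//|S T f [[s] SE] fsurj|S T f [_ SE] Tinh finj|I F FE].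
- split=> [|e /SE Se phi]; first by split; exact: f s.
  have /choice[lift liftP] i : exists s, f s = phi i by apply: fsurj.
  have -> : phi = (fun i => f (lift i)) by apply: functional_extensionality_dep => i; rewrite liftP.
  by rewrite -!morph_eval Se.
- by split=> // e /SE Se phi; apply: finj; rewrite !morph_eval.
- split=> [|e Ee phi].
    have Finh i : exists x : F i, True by case: (FE i) => -[x]; exists x.
    by split=> i; exact: (projT1 (cid (Finh i))).
  apply: functional_extensionality_dep => i.
  by rewrite !eval_direct_product; apply: (FE i).2.
Qed.

Section Subsemigroup.
Variables (S : semigroupType) (D : S -> Prop).
Hypothesis D_mul : forall a b, D a -> D b -> D (a * b).

(** The closure proof is an argument of the type, so that the semigroup structure can be inferred
    from it. *)
Definition subsemigroup (_ : forall a b, D a -> D b -> D (a * b)) : Type := {a : S | D a}.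

Local Notation T := (subsemigroup D_mul).

HB.instance Definition _ := gen_eqMixin T.
HB.instance Definition _ := gen_choiceMixin T.

Definition subsemigroup_mul (a b : T) : T :=
  exist _ _ (D_mul (proj2_sig a) (proj2_sig b)).

Fact subsemigroup_mulA : associative subsemigroup_mul.
Proof. by move=> a b c; apply: eq_exist; apply: mulgA. Qed.

HB.instance Definition _ := isSemigroup.Build T subsemigroup_mulA.

Definition subsemigroup_val (a : T) : S := proj1_sig a.

HB.instance Definition _ :=
  isMultiplicative.Build T S subsemigroup_val (fun _ _ => erefl).

Lemma subsemigroup_val_inj : injective subsemigroup_val.
Proof. by move=> [a Da] [b Db] ab; apply: eq_exist. Qed.
End Subsemigroup.

(** * Birkhoff's theorem *)

Section Birkhoff.
Variables (W : semigroupType -> Prop) (S : semigroupType).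
Hypotheses (varW : variety W) (S_inh : inhabited S).
Hypothesis S_sat : forall e, class_satisfies W e -> satisfies S e.

Let wordS : Type := S * seq S.

Let evalS (T : semigroupType) (phi : S -> T) (w : wordS) : T :=
  foldl (fun a i => a * phi i) (phi w.1) w.2.

Let mulS (u v : wordS) : wordS := (u.1, u.2 ++ v.1 :: v.2).

Let evalS_mul (T : semigroupType) (phi : S -> T) u v :
  evalS phi (mulS u v) = evalS phi u * evalS phi v.
Proof.
rewrite /evalS /= foldl_cat /=; set a := foldl _ _ u.2.
by elim/last_ind: (v.2) => //= t x IH; rewrite !foldl_rcons IH mulgA.
Qed.

(** Pairs of words over [S] index the product below, where all members of [W] with all assignments
    would be too many to form a set. *)
Let separated (c : wordS * wordS) : Prop :=
  exists T : {T : semigroupType & S -> T},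
    W (projT1 T) /\ evalS (projT2 T) c.1 <> evalS (projT2 T) c.2.

Let separated_eval u v : evalS id u <> evalS id v -> separated (u, v).
Proof.
move=> uv; apply: contrapT => nsep; apply: uv.
(* Only finitely many elements of [S] occur in [u] and [v]; numbered by their places in [l], they
   become the letters of an identity. *)
pose l := u.1 :: v.1 :: u.2 ++ v.2.
pose code (w : wordS) := Word (index w.1 l) [seq index s l | s <- w.2].
have code_eval (T : semigroupType) (phi : nat -> T) w :
    eval phi (code w) = evalS (fun s => phi (index s l)) w.
  rewrite /eval /evalS /=; elim/last_ind: (w.2) => // t x IH.
  by rewrite map_rcons !foldl_rcons IH.
have evalE w : {subset w.1 :: w.2 <= l} -> eval (nth u.1 l) (code w) = evalS id w.
  move=> wl; rewrite code_eval /evalS nth_index; last by apply: wl; rewrite inE eqxx.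
  have : {subset w.2 <= l} by move=> s sw; apply: wl; rewrite inE sw orbT.
  elim/last_ind: (w.2) => // t x IH tl; rewrite !foldl_rcons IH.
    by rewrite nth_index // tl // mem_rcons inE eqxx.
  by move=> s st; apply: tl; rewrite mem_rcons inE st orbT.
rewrite -!evalE; last 2 first.
- by move=> s; rewrite !inE mem_cat => /orP[->|->]; rewrite ?orbT.
- by move=> s; rewrite !inE mem_cat => /orP[->|->]; rewrite ?orbT.
apply: (S_sat (e := (code u, code v))) => T WT phi /=.
rewrite !code_eval; apply: contrapT => neq; apply: nsep.
by exists (existT _ T (fun s => phi (index s l))).
Qed.

Let I := {c : wordS * wordS | separated c}.

(* The relatively free semigroup on [S] is generated by the images of the
   letters in a product of members of [W], one for every pair of words that
   some member of [W] separates; [S] is its quotient. *)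
Lemma birkhoff : W S.
Proof.
have [T TP] := choice (fun i : I => proj2_sig i).
pose P := direct_product (fun i => projT1 (T i)).
have WP : W P by apply: (variety_prod varW) => i; apply: (TP i).1.
pose gen (s : S) : P := fun i => projT2 (T i) s.
have genE w i : evalS gen w i = evalS (projT2 (T i)) w.
  rewrite /evalS; elim/last_ind: (w.2) => // t x IH.
  by rewrite !foldl_rcons -IH.
pose D (p : P) := exists w, p = evalS gen w.
have D_mul p q : D p -> D q -> D (p * q).
  by move=> [u ->] [v ->]; exists (mulS u v); rewrite evalS_mul.
pose G := subsemigroup D_mul.
have WG : W G.
  apply: (variety_sub varW (f := @subsemigroup_val _ _ D_mul)) WP _ _.
    by case: S_inh => s; split; exists (gen s), (s, [::]).
  exact: subsemigroup_val_inj.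
have [pick pickP] := choice (fun g : G => proj2_sig g).
pose h (g : G) : S := evalS id (pick g).
(* The choice of a word for [g] is immaterial: words with different values in [S] are separated, so
   they differ in a coordinate of [P]. *)
have hE g w : proj1_sig g = evalS gen w -> h g = evalS id w.
  move=> gw; apply: contrapT => /separated_eval sep.
  have := (TP (exist _ _ sep)).2; apply=> /=.
  by rewrite -!genE -pickP gw.
have hM : {morph h : a b / a * b}.
  move=> a b; rewrite /h -evalS_mul; apply: hE.
  by rewrite evalS_mul -!pickP.
pose hm : {multiplicative G -> S} := HB.pack h (isMultiplicative.Build G S h hM).
apply: (variety_image varW (f := hm)) WG _ => s.
have Ds : D (gen s) by exists (s, [::]).
by exists (exist _ _ Ds); apply: (hE _ (s, [::])).
Qed.
End Birkhoff.

(** * The generators of the variety *)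

Lemma spow_idem (S : semigroupType) (a : S) k : a * a = a -> spow a k = a.
Proof. by move=> aa; elim: k => // -[//|k] IH; rewrite -[LHS]/(a * spow a k.+1) IH. Qed.

Lemma eval_spow (S : semigroupType) (phi : nat -> S) w k :
  eval phi (spow w k) = spow (eval phi w) k.
Proof.
elim: k => // -[//|k] IH.
by rewrite -[spow w _]/(w * spow w k.+1) eval_mul IH.
Qed.

Lemma basis_sat n (S : semigroupType) : (forall a : S, spow a n.+1 = spow a n) ->
  (forall a b : S, a * b * a = a * a * b) -> forall e, basis n e -> satisfies S e.
Proof.
move=> powS xyxS e [->|->] phi.
  rewrite -[LHS]/(eval phi (spow (letter 0) n.+1)).
  by rewrite -[RHS]/(eval phi (spow (letter 0) n)) !eval_spow powS.
by rewrite /= !eval_mul xyxS.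
Qed.

Lemma models_LZ2 n : models (basis n) (adjoin1 LZ2).
Proof.
split; first by split; exact: None.
by apply: basis_sat => [a|[a|] [b|]] //; rewrite !spow_idem //; case: a.
Qed.

Section NilmonCount.
Variable n : nat.
Hypothesis n_gt0 : (0 < n)%N.

(** The exponent of an element, which is 0 for the adjoined identity and [n] for the zero; products
    become sums capped at [n]. *)
Let rank (a : adjoin1 (nilmon n)) : nat := if a is Some i then (nat_of_ord i).+1 else 0.

Let rank_inj : injective rank.
Proof. by move=> [i|] [j|] //= [] /ord_inj->. Qed.

Let rank_mul a b : rank (a * b) = minn n (rank a + rank b).
Proof.
case: a b => [i|] [j|] /=; rewrite ?addn0 ?add0n ?minn0 //.
- by rewrite -minnSS prednK // minnC addnS addSn.
- by rewrite (minn_idPr (ltn_ord i)).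
- by rewrite (minn_idPr (ltn_ord j)).
Qed.

Lemma models_nilmon : models (basis n) (adjoin1 (nilmon n)).
Proof.
split; first by split; exact: None.
apply: basis_sat => [a|a b]; apply: rank_inj; last first.
  by rewrite !rank_mul; lia.
have rank_pow k : rank (spow a k.+1) = minn n (k.+1 * rank a).
  elim: k => [|k IH].
    by rewrite mul1n; case: (a) => [i|] /=; rewrite ?minn0 // (minn_idPr (ltn_ord i)).
  by rewrite -[spow _ _]/(a * spow a k.+1) rank_mul IH; lia.
have := rank_pow n.-1; rewrite prednK // => ->; rewrite rank_pow.
by case: (rank a) => [|r]; nia.
Qed.

Lemma count_eval_nilmon x : exists phi : nat -> adjoin1 (nilmon n), forall w,
  rank (eval phi w) = minn n (count_mem x (letters w)).
Proof.
(* The ordinal 0 stands for the generator. *)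
exists (fun i => if i == x then Some (Ordinal n_gt0 : nilmon n) else None).
elim/word_ind=> [i|w i IH]; first by rewrite eval_letter /= addn0; case: eqP => /=; lia.
rewrite eval_mul rank_mul IH eval_letter letters_mul count_cat /= addn0.
by case: (i == x) => /=; lia.
Qed.

Lemma nilmon_count u v : satisfies (adjoin1 (nilmon n)) (u, v) -> forall x,
  minn n (count_mem x (letters u)) = minn n (count_mem x (letters v)).
Proof.
by move=> sat x; have [phi phiE] := count_eval_nilmon x; rewrite -!phiE (sat phi).
Qed.
End NilmonCount.

(** Where the two lists first differ, in [x] and [y], sending these to the two left zeros and all
    other letters to the identity reveals which of them occurs first. *)
Lemma LZ2_firsts u v : satisfies (adjoin1 LZ2) (u, v) -> letters u =i letters v ->
  firsts (letters u) = firsts (letters v).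
Proof.
move=> sat uv.
have Some_mul b (a : adjoin1 LZ2) : (Some b : adjoin1 LZ2) * a = Some b by case: a.
pose prod (phi : nat -> adjoin1 LZ2) s := foldr (fun i a => phi i * a) None s.
have prod_cat phi s t : prod phi (s ++ t) = prod phi s * prod phi t.
  by elim: s => [|i s IH] /=; rewrite ?mul1g // IH mulgA.
have evalE phi w : eval phi w = prod phi (letters w).
  elim/word_ind: w => [i|w i IH]; first by rewrite /= mulg1.
  by rewrite eval_mul letters_mul prod_cat IH /= mulg1.
have prod_filter phi x s : phi x = None -> prod phi [seq i <- s | i != x] = prod phi s.
  move=> phix; elim: s => //= i s IH; case: eqP => [->|_] /=; rewrite IH //.
  by rewrite phix mul1g.
have prod_firsts phi s : prod phi (firsts s) = prod phi s.
  elim: s => //= i s <-; case phii: (phi i) => [b|]; first by rewrite !Some_mul.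
  by rewrite prod_filter.
have nil P V s t : firsts (letters s) = P -> firsts (letters t) = P ++ V ->
    letters s =i letters t -> V = [::].
  case: V => // y V sE tE st; have yt : y \in letters t.
    by rewrite -mem_firsts tE mem_cat inE eqxx orbT.
  have := firsts_uniq (letters t); rewrite tE cat_uniq => /and3P[_ /hasPn/(_ y) + _].
  by rewrite -sE mem_firsts st yt inE eqxx => /(_ isT).
suff main P U V : firsts (letters u) = P ++ U -> firsts (letters v) = P ++ V -> U = V.
  exact: (main [::]).
elim: U P V => [|x U IH] P V uE vE.
  by apply/esym/(nil P _ u v) => //; rewrite uE cats0.
case: V vE => [|y V] vE; first by apply: (nil P _ v u) => //; rewrite vE cats0.
have [xy|xy] := eqVneq x y.
  by rewrite -xy in vE *; congr (_ :: _); apply: (IH (rcons P x)); rewrite cat_rcons.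
pose phi i : adjoin1 LZ2 :=
  if i == x then Some true else if i == y then Some false else None.
have phiP : prod phi P = None.
  have := firsts_uniq (letters u); have := firsts_uniq (letters v).
  rewrite uE vE !(uniq_catC P) /= !mem_cat !negb_or => /andP[/andP[_ yP] _] /andP[/andP[_ xP] _].
  elim: (P) xP yP => //= i Q IHQ; rewrite !inE !negb_or => /andP[xi /IHQ{}IHQ] /andP[yi /IHQ->].
  by rewrite /phi eq_sym (negbTE xi) eq_sym (negbTE yi).
have := sat phi; rewrite /= !evalE -!(prod_firsts phi (letters _)) uE vE !prod_cat phiP !mul1g /=.
have -> : phi x = Some true by rewrite /phi eqxx.
have -> : phi y = Some false by rewrite /phi eq_sym (negbTE xy) eqxx.
by rewrite !Some_mul.
Qed.

Lemma profile_of_satisfies n u v : (0 < n)%N ->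
  satisfies (adjoin1 LZ2) (u, v) -> satisfies (adjoin1 (nilmon n)) (u, v) ->
  profile n (letters u) = profile n (letters v).
Proof.
move=> n0 satL /(nilmon_count n0) satN; rewrite /profile (LZ2_firsts satL).
  by apply: eq_map => x; rewrite satN.
move=> x; rewrite -!has_pred1 !has_count.
by move: (satN x); lia.
Qed.

(** * Infinitely many subvarieties *)

(* [Some set0], which would be an identity element for disjoint union, is made
   to annihilate everything, so that this semigroup is nilpotent. *)
Definition disjoint_sets (k : nat) : Type := option {set 'I_k}.

Section DisjointSets.
Variable k : nat.

HB.instance Definition _ := Choice.on (disjoint_sets k).

Definition disjoint_sets_mul (a b : disjoint_sets k) : disjoint_sets k :=
  if a isn't Some A then None else if b isn't Some B then None else
  if [&& A != finset.set0, B != finset.set0 & [disjoint A & B]] then Some (A :|: B) else None.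

Fact disjoint_sets_mulC : commutative disjoint_sets_mul.
Proof.
move=> [A|] [B|] //=; rewrite finset.setUC disjoint_sym.
by case: (A == finset.set0); case: (B == finset.set0).
Qed.

Fact disjoint_sets_mulA : associative disjoint_sets_mul.
Proof.
move=> [A|] [B|] [C|] //=; last by case: ifP.
case: (boolP (A == finset.set0)) => [A0|A0]; case: (boolP (B == finset.set0)) => [B0|B0];
  case: (boolP (C == finset.set0)) => [C0|C0]; rewrite /= ?(negbTE A0) ?B0 ?C0 //=.
all: do ?[by case: ifP => _ /=; rewrite ?A0 ?B0 ?C0 ?andbF].
have AB0 : A :|: B != finset.set0 by rewrite finset.setU_eq0 (negbTE A0).
have BC0 : B :|: C != finset.set0 by rewrite finset.setU_eq0 (negbTE B0).
have dU : [disjoint A & B :|: C] = [disjoint A & B] && [disjoint A & C].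
  by rewrite -!finset.setI_eq0 finset.setIUr finset.setU_eq0.
have dU' : [disjoint A :|: B & C] = [disjoint A & C] && [disjoint B & C].
  by rewrite -!finset.setI_eq0 finset.setIUl finset.setU_eq0.
case BC: [disjoint B & C]; case AB: [disjoint A & B];
  rewrite /= ?A0 ?BC0 ?AB0 ?C0 ?dU ?dU' ?AB ?BC /= ?finset.setUA ?andbT ?andbF //.
Qed.

HB.instance Definition _ := isSemigroup.Build (disjoint_sets k) disjoint_sets_mulA.

(** Squares are [None], so both powers vanish; the other law follows from commutativity. *)
Lemma models_disjoint_sets n : (2 <= n)%N -> models (basis n) (disjoint_sets k).
Proof.
move=> n2; split; first by split; exact: None.
have mulC (a b : disjoint_sets k) : a * b = b * a by apply: disjoint_sets_mulC.
apply: basis_sat => [a|a b]; last by rewrite -mulgA [b * a]mulC mulgA.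
have aa : a * a = None.
  case: a => [A|] //; rewrite -[LHS]/(disjoint_sets_mul (Some A) (Some A)) /=.
  rewrite -finset.setI_eq0 finset.setIid.
  by case: (A == finset.set0).
have spow0 m : spow a m.+2 = None.
  elim: m => [//|m IH].
  by rewrite -[LHS]/(a * spow a m.+2) IH mulC.
by case: n n2 => [|[|m]] // _; rewrite !spow0.
Qed.

(** In a product other than [None], every factor after the first adds at least one element. The
    first factor is not counted, as it may be the empty set when it stands alone. *)
Lemma eval_disjoint_sets (phi : nat -> disjoint_sets k) i s (A : {set 'I_k}) :
  eval phi (Word i s) = Some A -> (size s <= k)%N.
Proof.
suff main : eval phi (Word i s) = Some A -> (size s <= #|A|)%N.
  by move=> /main/leq_trans; apply; rewrite -[X in (_ <= X)%N]card_ord max_card.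
elim/last_ind: s A => // s x IH A.
have -> : Word i (rcons s x) = Word i s * letter x by rewrite -cats1.
rewrite eval_mul eval_letter size_rcons.
case: (eval phi _) IH => [B|] // /(_ _ erefl) sB.
rewrite [LHS]/(disjoint_sets_mul (Some B) (phi x)) /=.
case: (phi x) => [C|] //; case: ifP => // /and3P[_ C0 dBC] [<-].
rewrite cardsU (finset.disjoint_setI0 dBC) cards0 subn0 -addn1 leq_add //.
by rewrite card_gt0.
Qed.
End DisjointSets.

Lemma word_iotaS k : Word 0 (iota 1 k.+1) = Word 0 (iota 1 k) * letter k.+1.
Proof. by rewrite -[k.+1 in LHS]addn1 iotaD add1n. Qed.

(** In a semigroup with zero this law says that all products of [k.+1] factors vanish, since the
    last letter may be set to zero. *)
Definition nil_identity (k : nat) : identity :=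
  (Word 0 (iota 1 k), Word 0 (iota 1 k.+1)).

Lemma disjoint_sets_nil_identity k m : (k < m)%N ->
  satisfies (disjoint_sets k) (nil_identity m).
Proof.
move=> km phi; have none s : (k < size s)%N -> eval phi (Word 0 s) = None.
  move=> ks; case evalE: (eval _ _) => [A|] //.
  by move: (eval_disjoint_sets evalE); rewrite leqNgt ks.
apply: (etrans (none _ _) (esym (none _ _))); rewrite size_iota //.
exact: ltnW.
Qed.

Lemma disjoint_sets_not_nil_identity k m : (m < k)%N ->
  ~ satisfies (disjoint_sets k) (nil_identity m).
Proof.
(* Distinct singletons keep the left-hand side away from [None], while the extra letter on the right
   is sent to [None]. *)
case: k => // k mk; pose phi i : disjoint_sets k.+1 :=
  if (i <= m)%N then Some [set inord i] else None.
have some j : (j <= m)%N -> exists A : {set 'I_k.+1},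
    [/\ eval phi (Word 0 (iota 1 j)) = Some A, A != finset.set0 & forall i, i \in A -> (i <= j)%N].
  elim: j => [_|j IH jm].
    exists [set inord 0]; split=> //; first by apply/finset.set0Pn; exists (inord 0); rewrite inE.
    by move=> i; rewrite inE => /eqP->; rewrite inordK.
  have [A [evalE A0 Aj]] := IH (ltnW jm).
  have jk : (j.+1 < k.+1)%N by apply: leq_ltn_trans mk.
  exists (A :|: [set inord j.+1]); split.
  - rewrite word_iotaS eval_mul eval_letter evalE [phi _]/phi jm.
    rewrite -[LHS]/(disjoint_sets_mul (Some A) (Some [set inord j.+1])) /= A0.
    rewrite -card_gt0 cards1 disjoint_sym disjoints1.
    case: ifP => // /negbT; rewrite negbK => /Aj.
    by rewrite inordK // ltnn.
  - by rewrite finset.setU_eq0 (negbTE A0).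
  - move=> i; rewrite !inE => /orP[/Aj/leqW //|/eqP->].
    by rewrite inordK.
have [A [evalE _ _]] := some m (leqnn m).
move=> /(_ phi); rewrite [LHS]evalE.
rewrite -[RHS]/(eval phi (Word 0 (iota 1 m.+1))) word_iotaS.
by rewrite eval_mul eval_letter evalE [phi _]/phi ltnn.
Qed.

Lemma var2_variety (S T : semigroupType) (M : semigroupType -> Prop) :
  variety M -> M S -> M T -> variety (var2 S T).
Proof.
move=> varM MS MT; split=> [U VU|U U' f VU fsurj V varV VS VT|
  U U' f VU U'_inh finj V varV VS VT|I F VF V varV VS VT].
- exact (variety_nonempty varM (VU M varM MS MT)).
- exact (variety_image varV (VU V varV VS VT) fsurj).
- exact (variety_sub varV (VU V varV VS VT) U'_inh finj).
- by apply: (variety_prod varV) => i; apply: VF.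
Qed.

(** * The identity basis and the lattice of subvarieties *)

Section MainVariety.
Variable n : nat.
Hypothesis n_gt0 : (0 < n)%N.

Let V := var2 (adjoin1 LZ2) (adjoin1 (nilmon n)).

Let V_variety : variety V.
Proof.
exact: var2_variety (models_variety _) (models_LZ2 n) (models_nilmon n_gt0).
Qed.

Lemma var2_identity_basis : identity_basis V (basis n).
Proof.
split=> [e be S VS|[u v] Ve].
  have [_] := VS _ (models_variety _) (models_LZ2 n) (models_nilmon n_gt0).
  exact.
have VL : V (adjoin1 LZ2) by move=> M.
have VN : V (adjoin1 (nilmon n)) by move=> M.
apply/ded_letters/(ded_profile n_gt0); first by move=> e; apply: deducible_ax.
by apply: profile_of_satisfies => //; apply: Ve.
Qed.

Lemma var2_models S : models (basis n) S -> V S.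
Proof.
move=> [S_inh S_sat]; apply: (birkhoff V_variety S_inh) => e Ve.
exact: satisfies_deducible S_sat _ (var2_identity_basis.2 e Ve).
Qed.

Definition identities (W : semigroupType -> Prop) : set identity :=
  fun e => class_satisfies W e.

Lemma models_identities W : variety W -> models (identities W) = W.
Proof.
move=> varW; apply: functional_extensionality_dep => S; apply/propext.
split=> [[S_inh S_sat]|WS]; first exact: birkhoff.
by split=> [|e We]; [exact (variety_nonempty varW WS) | apply: We].
Qed.

(** Subvarieties are counted through their theories, from which [models_identities] recovers them;
    theories form a set on which cardinals are available. *)
Let theories : set (set identity) :=
  fun I => exists2 W, subvariety V W & I = identities W.

(** Every theory is generated over the basis by a finite list of pairs of words, and there are
    countably many such lists. *)
Let theories_countable : countable theories.
Proof.
pose F (l : seq (seq nat * seq nat)) : set identity :=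
  fun e => deducible (basis n `|` identities_of l)%classic e.
apply: (@sub_countable _ _ _ [set: seq (seq nat * seq nat)]%classic); last exact: countableP.
apply: card_le_trans (card_image_le F _); apply: subset_card_le.
move=> _ [W [varW WV] ->].
have [|l lE] := @finitely_based n (identities W) n_gt0.
  move=> e be; apply: deducible_ax => S /WV VS.
  exact: var2_identity_basis.1 be S VS.
exists l => //; apply: funext => e; apply/propext; rewrite /F -lE; split.
  by move=> de S WS; apply: satisfies_deducible de => e' We'; apply: We'.
exact: deducible_ax.
Qed.

Hypothesis n_gt1 : (1 < n)%N.

Let theories_infinite : infinite_set theories.
Proof.
(* Doubling the index leaves room for [j.*2.-1] strictly between [i.*2] and [j.*2]; the semigroup
   [disjoint_sets j.*2.-1] then lies in [W j] but not in [W i]. *)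
pose W i := models (basis n `|` [set nil_identity i.*2])%classic.
have W_sub i : theories (identities (W i)).
  exists (W i) => //; split; first exact: models_variety.
  by move=> S [S_inh S_sat]; apply: var2_models; split=> // e be; apply: S_sat; left.
have W_lt i j : (i < j)%N -> identities (W i) <> identities (W j).
  move=> ij WE; have : identities (W i) (nil_identity i.*2).
    by move=> S [_]; apply; right.
  rewrite WE => /(_ (disjoint_sets j.*2.-1)) sat.
  apply: (@disjoint_sets_not_nil_identity j.*2.-1 i.*2); first by lia.
  apply: sat; have [inh basis_sat] := models_disjoint_sets j.*2.-1 n_gt1.
  split=> // e [be|->]; first exact: basis_sat.
  by apply: disjoint_sets_nil_identity; lia.
apply/infiniteP; have W_inj : injective (identities \o W).
  move=> i j /= WE; case: (ltngtP i j) => // ij; first by case: (W_lt _ _ ij).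
  by case: (W_lt _ _ ij).
apply: card_le_trans (_ : ((identities \o W) @` [set: nat])%classic #<= _)%card; last first.
  by apply: subset_card_le => _ [i _ <-]; apply: W_sub.
have := @inj_card_eq _ _ [set: nat]%classic (identities \o W) (in2W W_inj).
by rewrite card_eq_le => /andP[].
Qed.

Let theories_bij : exists f : nat -> set identity,
  (forall i j, f i = f j -> i = j) /\ (forall I, theories I <-> exists i, f i = I).
Proof.
have /card_esym/card_set_bijP[f [fI finj fsurj]] :=
  eq_card_nat theories_countable theories_infinite.
exists f; split=> [i j fij|I]; first by apply: finj; rewrite ?inE.
by split=> [/fsurj[i _ <-]|[i <-]]; [exists i | apply: fI].
Qed.

Lemma subvarieties_countably_infinite : countably_infinite (subvariety V).
Proof.
have [f [finj fE]] := theories_bij.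
have f_sub i : exists2 W, subvariety V W & f i = identities W.
  by apply/fE; exists i.
have f_models i : subvariety V (models (f i)) /\ identities (models (f i)) = f i.
  have [W [varW WV] ->] := f_sub i.
  by rewrite models_identities.
exists (fun i => models (f i)); split=> [i j fij|W].
  by apply: finj; rewrite -(f_models i).2 fij (f_models j).2.
split=> [[varW WV]|[i <-]]; last exact: (f_models i).1.
have /fE[i fi] : theories (identities W) by exists W.
by exists i; rewrite fi models_identities.
Qed.
End MainVariety.

Theorem propositionC15 (n : nat) (hn : (2 <= n)%N) :
  let V := var2 (adjoin1 LZ2) (adjoin1 (nilmon n)) in
  let x := letter 0 in
  let y := letter 1 in
  identity_basis V
    [set (spow x n.+1, spow x n); (x * y * x, x * x * y)]%classic /\
  countably_infinite (subvariety V).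
Proof.
have n_gt0 : (0 < n)%N by apply: ltnW.
split; first exact: var2_identity_basis.
exact: subvarieties_countably_infinite.
Qed.
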